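(* The value function $V:[0,+\infty)\to\mathbb{R}$ is a viscosity solution of the Hamilton-Jacobi-Bellman equation $$\rho\,\mathrm{v}(k)+H(k,\mathrm{v}'(k))=0\qquad\forall k>0. \qquad\text{(HJB)}$$ Consequently, if $V\in\mathcal{C}^1([0,+\infty),\mathbb{R})$, then $V$ is strictly increasing and is a solution of (HJB) in the classical sense.
   Context: Production function: $F:\mathbb{R}\to\mathbb{R}$ is $\mathcal{C}^1$ with $F'>0$ on $\mathbb{R}$, $F(0)=0$, $\lim_{x\to+\infty}F(x)=+\infty$, $L:=\lim_{x\to+\infty}F'(x)>0$; for some $0<\underline{k}<\overline{k}$, $F$ is concave on $[0,\underline{k}]$ and on $[\overline{k},+\infty)$ and convex on $[\underline{k},\overline{k}]$. Utility: $\rho>0$, and $u:[0,+\infty)\to\mathbb{R}$ is strictly increasing and strictly concave, continuous on $[0,+\infty)$ and $\mathcal{C}^2$ on $(0,+\infty)$, with $u(0)=0$, $\lim_{x\to+\infty}u(x)=+\infty$, $\lim_{x\to0^+}u'(x)=+\infty$, $\lim_{x\to+\infty}u'(x)=0$; $\epsilon_0>0$ is a fixed constant with $\lim_{t\to+\infty}e^{\epsilon_0 t}e^{-\rho t}u\left(e^{(L+\epsilon_0)t}\right)=0$. State equation: for $k_0\ge0$ and $c\in\mathcal{L}^1_{loc}([0,+\infty),\mathbb{R})$ (integrable on each bounded interval $[0,T]$), $k(\cdot;k_0,c)$ is the unique (locally absolutely continuous) solution of $k(0)=k_0$, $\dot k(t)=F(k(t))-c(t)$ for (a.e.) $t\ge0$.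 Admissible controls: $\Lambda(k_0)$ is the set of $c\in\mathcal{L}^1_{loc}([0,+\infty),\mathbb{R})$ such that $c\ge0$ almost everywhere and $k(\cdot;k_0,c)\ge0$ (i.e. the solution is defined and nonnegative on all of $[0,+\infty)$). Functional and value function: $U(c;k_0):=\int_0^{+\infty}e^{-\rho t}u(c(t))\,dt$ for $c\in\Lambda(k_0)$, and $V:[0,+\infty)\to\mathbb{R}$, $V(k_0):=\sup_{c\in\Lambda(k_0)}U(c;k_0)$. The class $\mathcal{C}^+$: a continuous $f:(0,+\infty)\to\mathbb{R}$ belongs to $\mathcal{C}^+((0,+\infty),\mathbb{R})$ iff for every $k_0>0$ there exist $\delta,C^+,C^->0$ such that $\frac{f(k_0+h)-f(k_0)}{h}\ge C^+$ for all $h\in(0,\delta)$ and $\frac{f(k_0+h)-f(k_0)}{h}\ge C^-$ for all $h\in(-\delta,0)$. Hamiltonian: $H:[0,+\infty)\times(0,+\infty)\to\mathbb{R}$, $H(k,p):=-\sup\{[F(k)-c]\,p+u(c)\;:\;c\in[0,+\infty)\}$. A classical solution of (HJB) is a function $\mathrm{v}\in\mathcal{C}^+((0,+\infty),\mathbb{R})\cap\mathcal{C}^1((0,+\infty),\mathbb{R})$ satisfying $\rho\mathrm{v}(k)+H(k,\mathrm{v}'(k))=0$ for all $k>0$. Viscosity solutions: a function $v\in\mathcal{C}^+((0,+\infty),\mathbb{R})$ is a viscosity subsolution [supersolution] of (HJB) iff for every $\varphi\in\mathcal{C}^1((0,+\infty),\mathbb{R})$ and every local maximum [minimum] point $k_0>0$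 of $v-\varphi$ one has $\rho v(k_0)+H(k_0,\varphi'(k_0))\le0$ [$\ge0$]. (At such points $\varphi'(k_0)>0$ because $v\in\mathcal{C}^+$, so the expression is well defined.) It is a viscosity solution if it is both a viscosity subsolution and a viscosity supersolution. For $V$ these notions refer to its restriction to $(0,+\infty)$. *)

(* Defs.v *)
From HB Require Import structures.
From mathcomp Require Import all_boot all_order all_algebra.
From mathcomp Require Import all_classical all_reals all_analysis.

Set Implicit Arguments.
Unset Strict Implicit.
Unset Printing Implicit Defensive.

Import Order.TTheory GRing.Theory Num.Theory.
Import numFieldNormedType.Exports.

Local Open Scope classical_set_scope.
Local Open Scope ring_scope.

(* Overrides the notation for the formal derivative of polynomials. *)
Local Notation "f ^` ()" := (derive1 f) : ring_scope.

(* Functions on [0, +oo) or (0, +oo) are represented by total functions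
   R -> R; every definition below only inspects their values on the stated
   domain. *)

Definition concave_function (R : realType) (D : set R) (f : R -> R) : Prop :=
  convex_function (D : set R^o) (fun x => - f x).

Definition strictly_concave_function (R : realType) (D : set R) (f : R -> R)
    : Prop :=
  forall x y t : R, D x -> D y -> x != y -> 0 < t < 1 ->
    t * f x + (1 - t) * f y < f (t * x + (1 - t) * y).

Record production_function (R : realType) (F : R -> R) (L : R) : Prop := {
  prod_derivable : forall x : R, derivable F x 1 ;
  prod_cont_derive : continuous (F^`()) ;
  prod_derive_gt0 : forall x : R, 0 < F^`() x ;
  prod_0 : F 0 = 0 ;
  prod_pinfty : F x @[x --> +oo] --> +oo ;
  prod_derive_pinfty : F^`() x @[x --> +oo] --> L ;
  prod_L_gt0 : 0 < L ;
  prod_shape : exists kl ku : R, [/\ 0 < kl, kl < ku,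
    concave_function `[0, kl] F,
    convex_function (`[kl, ku]%classic : set R^o) F &
    concave_function `[ku, +oo[ F]
}.

Record utility_function (R : realType) (u : R -> R) : Prop := {
  util_increasing : forall x y : R, 0 <= x -> x < y -> u x < u y ;
  util_concave : strictly_concave_function `[0, +oo[ u ;
  util_continuous : {within `[0, +oo[, continuous u} ;
  util_derivable : forall x : R, 0 < x -> derivable u x 1 ;
  util_derivable2 : forall x : R, 0 < x -> derivable u^`() x 1 ;
  util_cont_derive2 : forall x : R, 0 < x -> {for x, continuous u^`()^`()} ;
  util_0 : u 0 = 0 ;
  util_pinfty : u x @[x --> +oo] --> +oo ;
  util_derive_0 : u^`() x @[x --> 0^'+] --> +oo ;
  util_derive_pinfty : u^`() x @[x --> +oo] --> (0 : R)
}.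

Definition growth_condition (R : realType) (u : R -> R) (rho L eps0 : R)
    : Prop :=
  expR (eps0 * t) * expR (- (rho * t)) * u (expR ((L + eps0) * t))
    @[t --> +oo] --> (0 : R).

Definition L1_loc (R : realType) (c : R -> R) : Prop :=
  forall T : R, 0 <= T -> (@lebesgue_measure R).-integrable `[0, T] (EFin \o c).

(* The intervals [x i, y i] are required to be non-overlapping, which is
   disjointness of their interiors. *)
Definition absolutely_continuous (R : realType) (a b : R) (f : R -> R) : Prop :=
  forall e : R, 0 < e -> exists2 d : R, 0 < d &
    forall (n : nat) (x y : 'I_n -> R),
      (forall i, [/\ a <= x i, x i <= y i & y i <= b]) ->
      trivIset [set: 'I_n] (fun i => `]x i, y i[%classic) ->
      \sum_(i < n) (y i - x i) < d ->
      \sum_(i < n) `|f (y i) - f (x i)| < e.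

Definition state_solution (R : realType) (F : R -> R) (k0 : R)
    (c k : R -> R) : Prop :=
  [/\ k 0 = k0,
      forall T : R, 0 <= T -> absolutely_continuous 0 T k &
      {ae (@lebesgue_measure R), forall t : R, 0 <= t ->
        is_derive t (1 : R) k (F (k t) - c t)}].

(* Solutions are unique on [0, +oo), F being locally Lipschitz, so that the
   existential over k speaks of the solution; as F is not restricted at -oo,
   its existence on all of [0, +oo) is part of admissibility. *)
Definition admissible (R : realType) (F : R -> R) (k0 : R) : set (R -> R) :=
  [set c | [/\ L1_loc c,
    {ae (@lebesgue_measure R), forall t : R, 0 <= t -> 0 <= c t} &
    exists2 k : R -> R, state_solution F k0 c k & forall t, 0 <= t -> 0 <= k t]].

(* The constraint 0 <= c t only removes the null set of times at which c t is
   outside the domain of u. *)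
Definition utility_functional (R : realType) (u : R -> R) (rho : R)
    (c : R -> R) : \bar R :=
  (\int[@lebesgue_measure R]_(t in `[0%R, +oo[ `&` [set t | (0 <= c t)%R])
     (expR (- (rho * t)) * u (c t))%:E)%E.

Definition value_function (R : realType) (F u : R -> R) (rho : R) (k0 : R)
    : \bar R :=
  ereal_sup [set utility_functional u rho c | c in admissible F k0].

Definition C1_pos (R : realType) (f : R -> R) : Prop :=
  (forall x : R, 0 < x -> derivable f x 1) /\
  (forall x : R, 0 < x -> {for x, continuous f^`()}).

(* C^1 on the closed half-line: the derivative, one-sided at 0, exists and is
   continuous on [0, +oo). *)
Definition C1_nonneg (R : realType) (f : R -> R) : Prop :=
  exists g : R -> R, [/\ {within `[0, +oo[, continuous g},
    forall x : R, 0 < x -> is_derive x (1 : R) f (g x) &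
    (f h - f 0) / h @[h --> 0^'+] --> g 0].

(* The guard 0 < k0 + h keeps the increment in the domain (0, +oo). *)
Definition Cplus (R : realType) (f : R -> R) : Prop :=
  (forall x : R, 0 < x -> {for x, continuous f}) /\
  forall k0 : R, 0 < k0 -> exists delta Cp Cm : R,
    [/\ 0 < delta, 0 < Cp, 0 < Cm,
        forall h : R, 0 < h < delta -> Cp <= (f (k0 + h) - f k0) / h &
        forall h : R, - delta < h < 0 -> 0 < k0 + h ->
          Cm <= (f (k0 + h) - f k0) / h].

(* Only meaningful for 0 < p, where the set is bounded above. *)
Definition hamiltonian (R : realType) (F u : R -> R) (k p : R) : R :=
  - sup [set (F k - c) * p + u c | c in `[0, +oo[ ].

Definition local_max (R : realType) (g : R -> R) (x : R) : Prop :=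
  \forall y \near x, g y <= g x.

Definition local_min (R : realType) (g : R -> R) (x : R) : Prop :=
  \forall y \near x, g x <= g y.

Definition viscosity_subsolution (R : realType) (F u : R -> R) (rho : R)
    (v : R -> R) : Prop :=
  Cplus v /\
  forall phi : R -> R, C1_pos phi -> forall k0 : R, 0 < k0 ->
    local_max (fun k : R => v k - phi k) k0 ->
    rho * v k0 + hamiltonian F u k0 (phi^`() k0) <= 0.

Definition viscosity_supersolution (R : realType) (F u : R -> R) (rho : R)
    (v : R -> R) : Prop :=
  Cplus v /\
  forall phi : R -> R, C1_pos phi -> forall k0 : R, 0 < k0 ->
    local_min (fun k : R => v k - phi k) k0 ->
    0 <= rho * v k0 + hamiltonian F u k0 (phi^`() k0).

Definition viscosity_solution (R : realType) (F u : R -> R) (rho : R)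
    (v : R -> R) : Prop :=
  viscosity_subsolution F u rho v /\ viscosity_supersolution F u rho v.

Definition classical_solution (R : realType) (F u : R -> R) (rho : R)
    (v : R -> R) : Prop :=
  [/\ Cplus v, C1_pos v &
    forall k : R, 0 < k -> rho * v k + hamiltonian F u k (v^`() k) = 0].

(* Main.v *)
(* No existence theory for the state equation is needed: a trajectory k is chosen
   first, and then the control is defined as F(k) - k'. Replacing k by k + h e^{-t}
   raises consumption by at least h e^{-t} and gives V in C^+; following a straight
   line k0 + v t for a time tau and then a nearly optimal trajectory gives
   V(k0) >= e^{-rho tau} (tau u(m) + V(k0 + v tau)), hence the continuity of V and
   the supersolution property.

   All upper bounds come from one inequality: if g is absolutely continuous and
   0 <= h <= g' almost everywhere on [a, b], then the integral of h is at most
   g(b) - g(a). With u(c) <= u(y) + (u(y)/y) c at y = e^{(L+eps0) t}, a combination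
   of e^{-eps0 t} and e^{-(L+eps0) t} k(t) as g gives the finiteness of V.

   For the subsolution property, controls are unbounded, so a trajectory is stopped
   at the first exit time, at most 1, from a ball around k0. Sublinearity of u turns
   a strict violation of the inequality at k0 into a defect of size eta (1 + c)
   along the trajectory, and eta (1 + c) integrates to a positive quantity bounded
   below: either the time or the displacement at the exit is not small. *)

Require Import Defs.
From mathcomp Require Import all_boot all_order all_algebra.
From mathcomp Require Import all_classical all_reals all_analysis.
From mathcomp Require Import measurable_realfun ring lra.

Import Order.TTheory GRing.Theory Num.Theory.
Import numFieldNormedType.Exports.

Set Implicit Arguments.
Unset Strict Implicit.
Unset Printing Implicit Defensive.

Local Open Scope classical_set_scope.
Local Open Scope ring_scope.

(** * Absolutely continuous functions *)

(** Trajectories are only absolutely continuous, and the state equation holds only almost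
    everywhere, whereas the estimates compare integrals with increments. A one-sided comparison is
    enough: the integrands are nonnegative payoffs or consumptions, and only upper bounds for them
    are drawn from the state equation. Each such bound amounts to finding a function of t and k(t)
    whose derivative along the trajectory dominates the integrand.

    In the subsolution property the defect eta (1 + c) is therefore never integrated. A multiple of
    al t + be k(t) is subtracted in g instead; its derivative al + be (F(k) - c) is dominated by the
    defect, and al, be are chosen after the exit so that al t + be k(t) has increased by a fixed
    amount.

    The gain behind C^+ has to be uniform over all controls although marginal utility vanishes for
    large consumption; a uniform bound on the integral of c over [0, 1] supplies this. *)

Lemma ac_dominated (R : realType) (a b M : R) (f g1 g2 : R -> R) :
  absolutely_continuous a b g1 -> absolutely_continuous a b g2 ->
  (forall x y, a <= x -> x <= y -> y <= b ->
    `|f y - f x| <= M * (`|g1 y - g1 x| + `|g2 y - g2 x|)) ->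
  absolutely_continuous a b f.
Proof.
move=> ac1 ac2 fM e e0.
pose N := `|M| + 1; have N0 : 0 < N by rewrite ltr_wpDl.
have e'0 : 0 < e / (2 * N) by rewrite divr_gt0 ?mulr_gt0.
have [d1 d10 h1] := ac1 _ e'0; have [d2 d20 h2] := ac2 _ e'0.
exists (Num.min d1 d2); first by rewrite lt_min d10.
move=> n x y xy dis sum; move: (sum); rewrite lt_min => /andP[s1 s2].
have := h1 n x y xy dis s1; have := h2 n x y xy dis s2.
set S2 := (X in X < _ -> _) => S2e; set S1 := (X in X < _ -> _) => S1e.
apply: (@le_lt_trans _ _ (N * (S1 + S2))).
  rewrite /S1 /S2 -big_split mulr_sumr; apply: ler_sum => i _.
  have [ax xyi yb] := xy i.
  apply: le_trans (fM _ _ ax xyi yb) _.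
  apply: ler_wpM2r; first by rewrite addr_ge0.
  by rewrite /N (le_trans (ler_norm M))// lerDl.
have : S1 + S2 < e / N.
  have -> : e / N = e / (2 * N) + e / (2 * N) by field; rewrite gt_eqF.
  exact: ltrD.
by rewrite ltr_pdivlMr// mulrC.
Qed.

Lemma ac_id (R : realType) (a b : R) : absolutely_continuous a b id.
Proof.
move=> e e0; exists e => // n x y xy _; apply: le_lt_trans.
by apply: ler_sum => i _; rewrite ger0_norm// subr_ge0; have [] := xy i.
Qed.

(** Monotonicity of the change of time keeps the image intervals non-overlapping, and the Lipschitz
    constant 1 keeps their total length below [d]. It serves the shift of a trajectory and the clock
    [Num.max (t - tau) 0]. *)
Lemma ac_comp_nondecreasing (R : realType) (a b a' b' : R) (s f : R -> R) :
  (forall x y, a <= x -> x <= y -> y <= b ->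
    [/\ a' <= s x, s x <= s y, s y <= b' & s y - s x <= y - x]) ->
  absolutely_continuous a' b' f -> absolutely_continuous a b (f \o s).
Proof.
move=> hs acf e e0; have [d d0 hd] := acf _ e0; exists d => // n x y xy dis sum.
apply: hd.
- move=> i; have [ax xyi yb] := xy i.
  by have [? ? ? ?] := hs _ _ ax xyi yb; split.
- apply/trivIsetP => i j _ _ ij; apply/seteqP; split => // z /=; rewrite !in_itv/=.
  move=> [] /andP[xiz zyi] /andP[xjz zyj].
  have lt p q : s (x p) < z -> z < s (y q) -> x p < y q.
    move=> xz zy; rewrite ltNge; apply/negP => yx.
    have [_ xyp ybp] := xy p; have [axq xyq _] := xy q.
    have := hs _ _ (le_trans axq xyq) yx (le_trans xyp ybp).
    by case=> _ + _ _; lra.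
  (* A common point of two image intervals orders the four endpoints so that the original intervals
     overlap as well; the midpoint of the overlap contradicts disjointness. *)
  have m1 : Num.max (x i) (x j) < Num.min (y i) (y j).
    by rewrite lt_min !gt_max !lt.
  move/trivIsetP : dis => /(_ i j I I ij); rewrite -subset0.
  move=> /(_ ((Num.max (x i) (x j) + Num.min (y i) (y j)) / 2)); apply => /=.
  rewrite !in_itv/=.
  have [] : [/\ x i <= Num.max (x i) (x j), x j <= Num.max (x i) (x j),
     Num.min (y i) (y j) <= y i & Num.min (y i) (y j) <= y j].
    by rewrite !le_max !ge_min !lexx !orbT.
  by move=> *; split; apply/andP; split; lra.
- apply: le_lt_trans sum; apply: ler_sum => i _.
  by have [ax xyi yb] := xy i; have [] := hs _ _ ax xyi yb.
Qed.

Lemma ac_uniform (R : realType) (a b : R) (f : R -> R) :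
  absolutely_continuous a b f -> forall e, 0 < e -> exists2 d, 0 < d &
    forall x y, a <= x <= b -> a <= y <= b -> `|y - x| < d ->
      `|f y - f x| < e.
Proof.
move=> acf e e0; have [d d0 hd] := acf e e0; exists d => //.
have key x y : a <= x -> x <= y -> y <= b -> y - x < d -> `|f y - f x| < e.
  move=> ax xy yb xyd; have := hd 1%N (fun=> x) (fun=> y).
  rewrite !big_ord_recl !big_ord0 !addr0; apply => //.
  apply/trivIsetP => i j _ _; rewrite !ord1 eqxx//.
move=> x y /andP[ax xb] /andP[ay yb]; have [xy|yx] := leP x y.
  by rewrite ger0_norm ?subr_ge0// => ?; exact: key.
by rewrite distrC ger0_norm ?subr_ge0 1?ltW// distrC => ?; apply: key => //; exact: ltW.
Qed.

Lemma ac_continuous (R : realType) (a b : R) (f : R -> R) :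
  absolutely_continuous a b f -> {within `[a, b], continuous f}.
Proof.
move=> acf; apply/subspace_continuousP => x; rewrite /= in_itv/= => abx.
apply/cvgrPdist_lt => e e0; have [d d0 hd] := ac_uniform acf e0.
rewrite near_withinE; apply: filterS (nbhsx_ballx x d d0) => y xy /=.
by rewrite in_itv/= => aby; rewrite distrC; apply: hd => //; rewrite distrC.
Qed.

(* Cousin's lemma, in the form of an additive relation on subintervals. *)
Lemma interval_chain (R : realType) (P : R -> R -> Prop) (a b : R) : a <= b ->
  (forall x y z, P x y -> P y z -> P x z) ->
  (forall t, a <= t <= b -> exists2 d, 0 < d & forall x y,
    a <= x -> t - d < x -> x <= t -> t <= y -> y < t + d -> y <= b -> P x y) ->
  P a b.
Proof.
move=> ab Ptrans Ploc.
pose S := [set t | a <= t <= b /\ P a t].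
have Sa : S a.
  split; first by rewrite lexx.
  have [|d d0] := Ploc a; first by rewrite lexx.
  by apply => //; rewrite ?ltrBlDr ?ltrDl.
have ubS : ubound S b by move=> t [/andP[]].
have supS : has_sup S by split; [exists a|exists b].
have as' : a <= sup S by apply: ub_le_sup => //; exists b.
have sb : sup S <= b by apply: ge_sup => //; exists a.
have [|d d0 hd] := Ploc (sup S); first by rewrite as'.
have [t St dt] := sup_adherent d0 supS.
have Pas : P a (sup S).
  have ts : t <= sup S by apply: ub_le_sup => //; exists b.
  case: St => /andP[at' tb] Pat; apply: Ptrans Pat _.
  by apply: hd => //; rewrite ltrDl.
move: sb; rewrite le_eqVlt => /predU1P[<-//|sb].
pose y := Num.min b (sup S + d / 2).
have sy : sup S < y by rewrite lt_min sb ltrDl divr_gt0.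
have yb : y <= b by rewrite ge_min lexx.
have yd : y < sup S + d.
  have : y <= sup S + d / 2 by rewrite ge_min lexx orbT.
  by lra.
suff : y <= sup S by rewrite leNgt sy.
apply: ub_le_sup; first by exists b.
split; first by rewrite yb (le_trans as')// ltW.
by apply: Ptrans Pas _; apply: hd => //; [rewrite ltrBlDr ltrDl|exact: ltW].
Qed.

(** Only intervals that contain [t] are controlled: their increment splits at [t] into two
    difference quotients. This is the local hypothesis of [interval_chain]. *)
Lemma derive_ge0_local (R : realType) (f : R -> R) (t df e : R) :
  is_derive t (1 : R) f df -> 0 <= df -> 0 < e -> exists2 d, 0 < d &
  forall x y, t - d < x -> x <= t -> t <= y -> y < t + d ->
    - (e * (y - x)) <= f y - f x.
Proof.
move=> [dft <-] df0 e0.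
have : h^-1 *: (f (h + t) - f t) @[h --> 0^'] --> 'D_1 f t.
  have /cvg_ex[l hl] := dft.
  rewrite /derive; move: hl.
  rewrite (_ : (fun h => h^-1 *: (f (h *: (1 : R) + t) - f t)) =
    (fun h => h^-1 *: (f (h + t) - f t))); last first.
    by apply/funext => h; rewrite [h *: _]mulr1.
  by move=> hl; rewrite (cvg_lim _ hl).
move=> /cvgrPdist_lt /(_ _ e0); rewrite near_withinE => /nbhs_ballP[d /= d0 hd].
exists d => // x y dx xt ty yd.
have key h : `|h| < d -> h != 0 -> - e < (f (h + t) - f t) / h.
  move=> hld h0; have := hd h; rewrite /ball/= sub0r normrN => /(_ hld h0).
  by rewrite ltr_distlC => /andP[+ _]; rewrite [_ *: _]mulrC; lra.
have right : - (e * (y - t)) <= f y - f t.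
  move: ty; rewrite le_eqVlt => /predU1P[<-|ty].
    by rewrite !subrr mulr0 oppr0.
  have yt0 : 0 < y - t by rewrite subr_gt0.
  have := key (y - t); rewrite gtr0_norm// subrK gt_eqF// ltr_pdivlMr//.
  rewrite ltrBlDl => /(_ yd isT); lra.
have left : - (e * (t - x)) <= f t - f x.
  move: xt; rewrite le_eqVlt => /predU1P[->|xt].
    by rewrite !subrr mulr0 oppr0.
  have xt0 : x - t < 0 by rewrite subr_lt0.
  have := key (x - t); rewrite ltr0_norm// subrK lt_eqF// ltr_ndivlMr// => /(_ _ isT).
  have h1 : - (x - t) < d by lra.
  move=> /(_ h1); lra.
by lra.
Qed.

Local Notation mu := (@lebesgue_measure _).

(* The null set of bad points is covered by an open set G of measure < d: absolute
   continuity bounds the total increment over disjoint subintervals of G, and the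
   sign of the derivative bounds the increments around the other points. *)
Lemma ac_nondecreasing (R : realType) (a b : R) (f : R -> R) : a <= b ->
  absolutely_continuous a b f ->
  {ae (@lebesgue_measure R), forall t, a <= t <= b ->
    exists2 df, 0 <= df & is_derive t (1 : R) f df} ->
  f a <= f b.
Proof.
move=> ab acf [N [mN N0 fN]].
suff H e : 0 < e -> - (e * (b - a)) - e <= f b - f a.
  rewrite -subr_ge0; apply/ler_addgt0Pr => e e0.
  have e'0 : 0 < e / (b - a + 1) by rewrite divr_gt0// ltr_wpDl// subr_ge0.
  have := H _ e'0.
  have -> : - (e / (b - a + 1) * (b - a)) - e / (b - a + 1) = - e.
    by field; apply/lt0r_neq0; lra.
  by lra.
move=> e0; have [d d0 hd] := acf _ e0.
have Noo : (mu N < +oo)%E by rewrite N0.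
have [G [oO NO mO]] := lebesgue_regularity_outer mN Noo d0.
have mesO : measurable G by exact: open_measurable.
have {}mO : (mu G < d%:E)%E.
  have : (mu G <= mu (G `\` N) + mu N)%E.
    have := measureU2 mu (measurableD mesO mN) mN; apply: le_trans.
    apply: le_measure; rewrite ?inE//.
      by apply: measurableU => //; exact: measurableD.
    by move=> x Gx; have [Nx|Nx] := pselect (N x); [right|left].
  by rewrite N0 adde0 => /le_lt_trans; apply.
(* Half-open intervals make [m] additive over adjacent intervals. *)
pose m x y := fine (mu (G `&` `]x, y]%classic)).
have mfin x y : mu (G `&` `]x, y]%classic) \is a fin_num.
  rewrite ge0_fin_numE//; apply: le_lt_trans (ltry d); apply/ltW.
  apply: le_lt_trans mO; apply: le_measure; rewrite ?inE//.
  exact: measurableI.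
(* The list holds the intervals charged to [G], whose increments are left to absolute continuity;
   concatenating ordered lists makes the relation transitive. *)
pose P x y := x <= y /\ exists s : seq (R * R),
  [/\ all (fun p => [&& x <= p.1, p.1 <= p.2 & p.2 <= y]) s,
      pairwise (fun p q => p.2 <= q.1) s,
      \sum_(p <- s) (p.2 - p.1) <= m x y &
      - (e * (y - x)) <= f y - f x + \sum_(p <- s) `|f p.2 - f p.1|].
have [||_ [s [alls pws ms fs]]] := @interval_chain R P a b ab.
- move=> x y z [xy [s1 [a1 p1 m1 f1]]] [yz [s2 [a2 p2 m2 f2]]].
  split; first exact: le_trans yz.
  exists (s1 ++ s2); split.
  + rewrite all_cat; apply/andP; split.
      by apply: sub_all a1 => p /and3P[-> -> py]; exact: le_trans yz.
    by apply: sub_all a2 => p /and3P[yp -> ->]; rewrite (le_trans xy yp).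
  + rewrite pairwise_cat p1 p2 !andbT; apply/allrelP => p q ps1 qs2.
    have /and3P[_ _ py] := allP a1 _ ps1; have /and3P[yq _ _] := allP a2 _ qs2.
    exact: le_trans py yq.
  + rewrite big_cat/=; apply: le_trans (lerD m1 m2) _.
    rewrite /m -fineD// -measureU//; last first.
    * apply/seteqP; split => // t [[_ /=]]; rewrite in_itv/= => /andP[_ ty] [_ /=].
      by rewrite in_itv/= ltNge ty.
    * exact: measurableI.
    * exact: measurableI.
    rewrite -setIUr -itv_bndbnd_setU//.
  + by rewrite big_cat/=; lra.
- move=> t abt; case: (pselect (G t)) => [Ot|Ot].
    have /nbhs_ballP[r /= r0 rO] : nbhs t G by apply: open_nbhs_nbhs.
    exists r => // x y ax xt1 xt2 ty1 ty2 yb.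
    have xy : x <= y by exact: le_trans ty1.
    split => //; exists [:: (x, y)]; split => //=.
    * by rewrite !lexx xy.
    * rewrite big_seq1/= /m.
      rewrite (_ : G `&` _ = `]x, y]%classic); last first.
        apply/setIidPr => z /=; rewrite in_itv/= => /andP[xz zy]; apply: rO.
        by rewrite /ball/= ltr_distlC; apply/andP; split; lra.
      rewrite lebesgue_measure_itv/= lte_fin; case: ltP => //= yx; lra.
    * rewrite big_seq1/=; have := ler_norm (- (f y - f x)); rewrite normrN.
      have : 0 <= e * (y - x) by rewrite mulr_ge0 ?subr_ge0// ltW.
      lra.
  have : ~ N t by move=> /NO.
  move=> Nt; have [df df0 fdf] : exists2 df, 0 <= df & is_derive t (1 : R) f df.
    apply: contrapT => H; apply/Nt/fN => /= H'; exact/H/H'.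
  have [r r0 hr] := derive_ge0_local fdf df0 e0; exists r => // x y ax ? ? ? ? ?.
  split; first exact: (@le_trans _ _ t).
  exists [::]; split => //; rewrite ?big_nil ?fine_ge0//.
  by rewrite addr0; exact: hr.
have ltd : \sum_(p <- s) (p.2 - p.1) < d.
  apply: le_lt_trans ms _; rewrite -lte_fin /m fineK//.
  by apply: le_lt_trans mO; apply: le_measure; rewrite ?inE//; exact: measurableI.
suff : \sum_(p <- s) `|f p.2 - f p.1| < e by lra.
have := hd (size s) (fun i => (nth (0, 0) s i).1) (fun i => (nth (0, 0) s i).2).
rewrite !(big_nth (0, 0)) !big_mkord in ltd *; apply => //.
- by move=> i; have /and3P[] := allP alls _ (mem_nth (0, 0) (ltn_ord i)).
- apply/trivIsetP => i j _ _ ij; apply/seteqP; split => // z [] /=.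
  have lt (p q : 'I_(size s)) : (p < q)%N -> (nth (0, 0) s p).2 <= (nth (0, 0) s q).1.
    by move=> pq; apply: (pairwiseP (0, 0) pws); rewrite ?inE.
  rewrite !in_itv/= => /andP[iz zi] /andP[jz zj].
  move: ij; rewrite -val_eqE neq_ltn => /orP[] /lt; lra.
Qed.

(** * Integrals bounded by increments of absolutely continuous functions *)

Lemma ae_imply (R : realType) (P Q : R -> Prop) :
  {ae (@lebesgue_measure R), forall t, P t} -> (forall t, P t -> Q t) ->
  {ae (@lebesgue_measure R), forall t, Q t}.
Proof. by move=> aeP PQ; apply: (@filterS _ _ (ae_filter_ringOfSetsType _)) aeP. Qed.

Lemma ae_imply2 (R : realType) (P Q S : R -> Prop) :
  {ae (@lebesgue_measure R), forall t, P t} ->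
  {ae (@lebesgue_measure R), forall t, Q t} ->
  (forall t, P t -> Q t -> S t) -> {ae (@lebesgue_measure R), forall t, S t}.
Proof.
by move=> aeP aeQ PQ; apply: (@filterS2 _ _ (ae_filter_ringOfSetsType _)) aeP aeQ.
Qed.

Lemma ac_lipschitz (R : realType) (a b M : R) (f : R -> R) :
  (forall x y, a <= x -> x <= y -> y <= b -> `|f y - f x| <= M * (y - x)) ->
  absolutely_continuous a b f.
Proof.
move=> lip; apply: (@ac_dominated _ a b (M / 2) f id id); [exact: ac_id..|].
move=> x y ax xy yb; apply: le_trans (lip _ _ ax xy yb) _.
by rewrite /= ger0_norm ?subr_ge0//; lra.
Qed.

Lemma acB (R : realType) (a b : R) (f g : R -> R) :
  absolutely_continuous a b f -> absolutely_continuous a b g ->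
  absolutely_continuous a b (f \- g).
Proof.
move=> acf acg; apply: (@ac_dominated _ a b 1 _ f g) => // x y _ _ _.
rewrite mul1r /=; have -> : f y - g y - (f x - g x) = (f y - f x) - (g y - g x) by ring.
exact: ler_normB.
Qed.

(** Subtracting from [g] a primitive of [h] leaves a function with nonnegative derivative almost
    everywhere, by Lebesgue differentiation. The bound [N] makes the primitive Lipschitz, hence
    absolutely continuous. *)
Lemma bounded_integral_le_ac (R : realType) (a b N : R) (h g : R -> R) : a <= b ->
  measurable_fun `[a, b] h -> (forall t, a <= t <= b -> 0 <= h t <= N) ->
  absolutely_continuous a b g ->
  {ae (@lebesgue_measure R), forall t, a <= t <= b ->
    exists2 dg, h t <= dg & is_derive t (1 : R) g dg} ->
  (\int[@lebesgue_measure R]_(t in `[a, b]) (h t)%:E <= (g b - g a)%:E)%E.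
Proof.
move=> ab mh hN acg gh.
pose H := h \_ `[a, b].
have H0N t : 0 <= H t <= N.
  have N0 : 0 <= N by have /andP[] := hN a (introT andP (conj (lexx a) ab)); apply: le_trans.
  rewrite /H patchE; case: ifPn => [|_]; last by rewrite lexx.
  by rewrite inE/= in_itv/= => /hN.
have mH : measurable_fun setT H by apply/(measurable_restrictT _ _).1.
have intH (x y : R) : (@lebesgue_measure R).-integrable `[x, y] (EFin \o H).
  apply: measurable_bounded_integrable => //.
  - exact/compact_finite_measure/segment_compact.
  - exact: measurable_funS mH.
  - exists N; split; first exact: num_real.
    move=> M NM t _ /=; have /andP[H0 HN] := H0N t.
    by rewrite ger0_norm// (le_trans HN)// ltW.
have locH : locally_integrable setT H.
  apply: integrable_locally => //; apply: eq_integrable (intH a b) => //.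
  by move=> t tab; rewrite /= /H patchE tab.
(* Starting at [a - 1] puts every point of [a, b], including [a], strictly to the right of the
   origin of the primitive, as the differentiation theorem demands. *)
pose G x : R := \int[@lebesgue_measure R]_(t in `[a - 1, x]) H t.
have := @FTC1 R H (BLeft (a - 1)) (fun y => intH (a - 1) y) locH; rewrite -/G => aeG.
have dG x y : x <= y -> a <= x -> G y - G x = \int[@lebesgue_measure R]_(t in `]x, y]) H t.
  move=> xy ax; rewrite /G (@Rintegral_itvB _ H (BLeft (a - 1)) (BRight y))//.
  by rewrite bnd_simp; lra.
have acG : absolutely_continuous a b G.
  apply: (@ac_lipschitz _ a b N) => x y ax xy yb; rewrite dG//.
  have xyfin : (@lebesgue_measure R `]x, y]%classic < +oo)%E.
    by rewrite lebesgue_measure_itv/=; case: ifP => // _; rewrite -EFinD ltry.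
  have intHxy : (@lebesgue_measure R).-integrable `]x, y] (EFin \o H).
    apply: integrableS (intH x y) => //; apply: subset_itvr; rewrite bnd_simp//.
  rewrite ger0_norm; last by apply: Rintegral_ge0 => t _; have /andP[] := H0N t.
  have -> : N * (y - x) = \int[@lebesgue_measure R]_(t in `]x, y]) N.
    rewrite Rintegral_cst//= lebesgue_measure_itv/= lte_fin; case: ltP => //= yx.
    by rewrite mulr0; have -> : y = x by [lra]; rewrite subrr mulr0.
  apply: le_Rintegral => //.
    apply: measurable_bounded_integrable => //; exists `|N|; split => // M NM t _ /=.
    exact: ltW.
  by move=> t _; have /andP[] := H0N t.
have ba : g a - G a <= g b - G b.
  apply: (ac_nondecreasing ab (acB acg acG)).
  apply: (ae_imply2 gh aeG) => t ght aeGt abt; have [dg hdg gdg] := ght abt.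
  have /andP[at_ tb] := abt.
  have [|dGt Gt] := aeGt; first by rewrite /= lte_fin; lra.
  exists (dg - H t).
    by rewrite subr_ge0 /H patchE ifT// inE/= in_itv.
  have dGH := DeriveDef dGt (etrans (esym (derive1E G t)) Gt).
  exact: is_deriveB gdg dGH.
have -> : (\int[@lebesgue_measure R]_(t in `[a, b]) (h t)%:E)%E = (G b - G a)%:E.
  rewrite dG// Rintegral_itv_obnd_cbnd; last first.
    by apply: integrableS (intH a b) => //; apply: subset_itvr; rewrite bnd_simp.
  rewrite /Rintegral fineK; last exact: integrable_fin_num (intH a b).
  by apply: eq_integral => t tab; rewrite /H patchE tab.
by rewrite lee_fin; lra.
Qed.

(** Truncating [h] at n gives the bounded case with a bound independent of n, which passes to the
    limit by monotone convergence. Unbounded controls require this form. *)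
Lemma ge0_integral_le_ac (R : realType) (a b : R) (h g : R -> R) : a <= b ->
  measurable_fun `[a, b] h -> (forall t, a <= t <= b -> 0 <= h t) ->
  absolutely_continuous a b g ->
  {ae (@lebesgue_measure R), forall t, a <= t <= b ->
    exists2 dg, h t <= dg & is_derive t (1 : R) g dg} ->
  (\int[@lebesgue_measure R]_(t in `[a, b]) (h t)%:E <= (g b - g a)%:E)%E.
Proof.
move=> ab mh h0 acg gh.
pose hn n t := Num.min (h t) n%:R.
have mhn n : measurable_fun `[a, b] (hn n) by apply: measurable_minr.
have hnh t : limn (fun n => (hn n t)%:E) = (h t)%:E.
  apply/cvg_lim => //; apply: cvg_near_cst; near=> n; congr EFin.
  by apply/min_idPl; near: n; exact: nbhs_infty_ger.
have hn0 n t : `[a, b]%classic t -> (0 <= (hn n t)%:E)%E.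
  by rewrite /= in_itv/= lee_fin => abt; rewrite le_min h0//=.
have hn_nd t : `[a, b]%classic t -> {homo (fun n => (hn n t)%:E) : n m / (n <= m)%N >-> (n <= m)%E}.
  move=> _ m n mn; rewrite lee_fin /hn le_min ge_min lexx/=.
  by rewrite ge_min ler_nat mn orbT.
have mEhn n : measurable_fun `[a, b] (fun t => (hn n t)%:E).
  exact/measurable_EFinP.
have -> : (\int[@lebesgue_measure R]_(t in `[a, b]) (h t)%:E =
    \int[@lebesgue_measure R]_(t in `[a, b]) limn (fun n => (hn n t)%:E))%E.
  by apply: eq_integral => t _; rewrite hnh.
rewrite (monotone_convergence (@lebesgue_measure R) (measurable_itv _) mEhn hn0 hn_nd).
apply: lime_le.
  apply: ereal_nondecreasing_is_cvgn => m n mn.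
  apply: ge0_le_integral; rewrite //; first exact: hn0.
  - exact: mEhn.
  - exact: mEhn.
  - by move=> t abt; exact: hn_nd abt _ _ mn.
apply: nearW => n; apply: (@bounded_integral_le_ac _ a b n%:R (hn n) g ab (mhn n) _ acg).
  move=> t abt; apply/andP; split; last by rewrite /hn ge_min lexx orbT.
  by rewrite /hn le_min h0/=.
apply: (ae_imply gh) => t ght /ght[dg hdg gdg]; exists dg => //.
by rewrite /hn ge_min hdg.
Unshelve. all: by end_near. Qed.

(** * Translations of Lebesgue measure *)

Lemma measurable_shift (R : realType) (s : R) :
  measurable_fun [set: R] ((fun t => t + s) : R -> R).
Proof. by apply: measurable_funD. Qed.

Lemma pushforward_shift (R : realType) (s : R) (A : set R) : measurable A ->
  pushforward (@lebesgue_measure R)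
    ((fun t => t + s) : measurableTypeR R -> measurableTypeR R) A
  = @lebesgue_measure R A.
Proof.
move=> mA.
apply/esym/lebesgue_measure_unique => //; first exact: measurable_shift.
move=> ? _ [[a b]] _ <-.
rewrite /= /pushforward (_ : _ @^-1` _ = `]a - s, b - s]%classic); last first.
  by apply/seteqP; split => t /=; rewrite !in_itv/= ltrBlDr lerBrDr.
rewrite [LHS]lebesgue_measure_itv/= lebesgue_measure_itv/= !lte_fin ltrD2r.
by case: ifP => // _; rewrite -!EFinD; congr EFin; ring.
Qed.

Lemma ae_shift (R : realType) (s : R) (P : R -> Prop) :
  {ae (@lebesgue_measure R), forall t, P t} ->
  {ae (@lebesgue_measure R), forall t, P (t + s)}.
Proof.
move=> [N [mN N0 PN]]; exists ((fun t => t + s) @^-1` N); split.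
- rewrite -[X in measurable X]setTI; exact: measurable_shift.
- by rewrite -N0 -(pushforward_shift s mN).
- by move=> t; exact: PN.
Qed.

Lemma ge0_integral_shift (R : realType) (s : R) (D : set R) (f : R -> \bar R) :
  measurable D -> measurable_fun D f -> (forall t, D t -> (0 <= f t)%E) ->
  (\int[@lebesgue_measure R]_(t in D) f t =
   \int[@lebesgue_measure R]_(t in (fun t => t + s)%R @^-1` D) f (t + s)%R)%E.
Proof.
move=> mD mf f0.
rewrite -[RHS](@ge0_integral_pushforward _ _ _ _ R
  ((fun t => t + s) : measurableTypeR R -> measurableTypeR R) (measurable_shift s)
  (@lebesgue_measure R) D f)//; last by move=> t /[!inE]; exact: f0.
by apply: eq_measure_integral => [|? A mA _];
  [exact: measurable_shift|exact/esym/pushforward_shift].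
Qed.

(** * Real functions *)

Lemma is_derive_addf (R : realType) (f g : R -> R) (t a b : R) :
  is_derive t (1 : R) f a -> is_derive t (1 : R) g b ->
  is_derive t (1 : R) (fun s => f s + g s) (a + b).
Proof. exact: is_deriveD. Qed.

Lemma is_derive_subf (R : realType) (f g : R -> R) (t a b : R) :
  is_derive t (1 : R) f a -> is_derive t (1 : R) g b ->
  is_derive t (1 : R) (fun s => f s - g s) (a - b).
Proof. exact: is_deriveB. Qed.

Lemma is_derive_mulf (R : realType) (f g : R -> R) (t a b : R) :
  is_derive t (1 : R) f a -> is_derive t (1 : R) g b ->
  is_derive t (1 : R) (fun s => f s * g s) (f t * b + g t * a).
Proof. exact: is_deriveM. Qed.

Lemma is_derive_scalef (R : realType) (k : R) (f : R -> R) (t a : R) :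
  is_derive t (1 : R) f a -> is_derive t (1 : R) (fun s => k * f s) (k * a).
Proof. exact: (@is_deriveZ _ _ _ f k). Qed.

Lemma is_derive_compf (R : realType) (f g : R -> R) (t a b : R) :
  is_derive (g t) (1 : R) f a -> is_derive t (1 : R) g b ->
  is_derive t (1 : R) (fun s => f (g s)) (a * b).
Proof. exact: is_derive1_comp. Qed.

Lemma is_derive_scale (R : realType) (k t : R) : is_derive t (1 : R) (fun s => k * s) k.
Proof. by have := is_derive_scalef k (@is_derive_id R R t 1); rewrite mulr1. Qed.

Lemma is_derive_expRM (R : realType) (k t : R) :
  is_derive t (1 : R) (fun s => expR (k * s)) (expR (k * t) * k).
Proof.
exact: (@is_derive_compf R expR (fun s => k * s) t _ k (is_derive_expR _) (is_derive_scale k t)).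
Qed.

Lemma is_derive_locally (R : realType) (f g : R -> R) (t a d : R) : 0 < d ->
  (forall s, `|s - t| < d -> f s = g s) ->
  is_derive t (1 : R) f a -> is_derive t (1 : R) g a.
Proof.
move=> d0 fg; apply: near_eq_is_derive.
apply: filterS (nbhsx_ballx t d d0) => s; rewrite /ball/= distrC => /fg ->//.
Qed.

Lemma is_derive_continuous (R : realType) (f : R -> R) (t a : R) :
  is_derive t (1 : R) f a -> {for t, continuous f}.
Proof. by move=> [df _]; apply/differentiable_continuous/derivable1_diffP. Qed.

Lemma mean_value (R : realType) (f : R -> R) (df : R -> R) (x y : R) : x <= y ->
  (forall t, x <= t <= y -> is_derive t (1 : R) f (df t)) ->
  exists2 c, x <= c <= y & f y - f x = df c * (y - x).
Proof.
move=> xy fdf; have [||c] := @MVT_segment R f df x y xy.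
- by move=> t; rewrite in_itv/= => /andP[xt ty]; apply: fdf; rewrite !ltW.
- apply: derivable_within_continuous => t; rewrite in_itv/= => xty.
  exact: (@ex_derive _ _ _ _ _ _ _ (fdf t xty)).
- by rewrite in_itv/= => xcy e; exists c.
Qed.

Lemma derive_ge0_right (R : realType) (f : R -> R) (t a d : R) : 0 < d ->
  is_derive t (1 : R) f a -> (forall h, 0 < h < d -> f t <= f (t + h)) -> 0 <= a.
Proof.
move=> d0 fa fh; rewrite leNgt; apply/negP => a0.
(* This function has derivative 0 at [t]; with error [- (a / 2)] the local estimate gives f(t + h) -
   f(t) <= (a / 2) h < 0 for small h > 0. *)
have fa' : is_derive t (1 : R) (fun s => a * s - f s) (a - a).
  by apply: is_derive_subf fa; exact: is_derive_scale.
have e0 : 0 < - (a / 2) by rewrite oppr_gt0; lra.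
have [|r r0 hr] := derive_ge0_local fa' _ e0; first by rewrite subrr.
pose h := Num.min r d / 2.
have hmin : 0 < Num.min r d by rewrite lt_min r0.
have hr' : h < r.
  have : Num.min r d <= r by rewrite ge_min lexx.
  by rewrite /h; lra.
have hd' : h < d.
  have : Num.min r d <= d by rewrite ge_min lexx orbT.
  by rewrite /h; lra.
have h0 : 0 < h by rewrite /h; lra.
have := fh h; rewrite h0 hd' => /(_ isT).
have := hr t (t + h); rewrite ltrBlDr ltrDl r0 lexx lerDl (ltW h0) ltrD2l hr'.
move=> /(_ isT isT isT isT).
have : a * h < 0 by rewrite pmulr_llt0.
nra.
Qed.

(** The exit time is the infimum of the times with [r <= f t]. Continuity excludes a smaller value
    there, since such times accumulate at the infimum, and a larger one, since [f < r] before it. *)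
Lemma first_exit (R : realType) (f : R -> R) (T r : R) : 0 <= T -> 0 < r ->
  (forall e, 0 < e -> exists2 d, 0 < d & forall x y,
    0 <= x <= T -> 0 <= y <= T -> `|y - x| < d -> `|f y - f x| < e) ->
  f 0 < r ->
  exists th, [/\ 0 <= th <= T, forall t, 0 <= t <= th -> f t <= r &
    th = T \/ f th = r].
Proof.
move=> T0 r0 fc f0.
have [ltr|] := pselect (forall t, 0 <= t <= T -> f t < r).
  exists T; split; [by rewrite T0 lexx|by move=> t /ltr/ltW|by left].
move=> /existsNP[t1 /not_implyP[t1T /negP]]; rewrite -leNgt => rt1.
pose S := [set t | 0 <= t <= T /\ r <= f t].
have lbS : lbound S 0 by move=> t [/andP[]].
have infS : has_inf S by split; [exists t1|exists 0].
have th0 : 0 <= inf S by apply: lb_le_inf => //; exists t1.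
have thT : inf S <= T.
  by case/andP : (t1T) => _; apply: le_trans; apply: ge_inf => //; exists 0.
have before t : 0 <= t -> t < inf S -> f t < r.
  move=> t0 tS; rewrite ltNge; apply/negP => rft.
  suff : inf S <= t by rewrite leNgt tS.
  apply: ge_inf; first by exists 0.
  by split => //; rewrite t0 (le_trans (ltW tS)).
have ge_r : r <= f (inf S).
  rewrite leNgt; apply/negP => lt_r; have [|d d0 hd] := fc (r - f (inf S)).
    by rewrite subr_gt0.
  have [t [tT rft] tS] := inf_adherent d0 infS.
  have St : inf S <= t by apply: ge_inf; [exists 0|].
  have := hd (inf S) t; rewrite th0 thT => /(_ isT tT).
  rewrite ger0_norm ?subr_ge0// ltrBlDl => /(_ tS).
  by have := ler_norm (f t - f (inf S)); lra.
have thgt0 : 0 < inf S.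
  rewrite lt_neqAle th0 andbT; apply/eqP => S0.
  by move: ge_r; rewrite -S0; lra.
have le_r : f (inf S) <= r.
  rewrite leNgt; apply/negP => gt_r; have [|d d0 hd] := fc (f (inf S) - r).
    by rewrite subr_gt0.
  pose t := Num.max 0 (inf S - d / 2).
  have t0 : 0 <= t by rewrite le_max lexx.
  have td : inf S - d / 2 <= t by rewrite le_max lexx orbT.
  have tS : t < inf S by rewrite gt_max thgt0; lra.
  have := hd (inf S) t; rewrite th0 thT t0 (le_trans (ltW tS) thT) => /(_ isT isT).
  rewrite distrC ger0_norm; last by lra.
  have tdd : inf S - t < d by lra.
  move=> /(_ tdd); have := before t t0 tS; have := ler_norm (- (f t - f (inf S))).
  rewrite normrN; lra.
exists (inf S); split; first by rewrite th0.
- move=> t /andP[t0]; rewrite le_eqVlt => /predU1P[->//|tS].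
  exact/ltW/before.
- by right; apply/eqP; rewrite eq_le le_r.
Qed.

(** * Utility and production *)

Section Utility.
Variables (R : realType) (u : R -> R).
Hypothesis hu : utility_function u.

Lemma util_nd x y : 0 <= x -> x <= y -> u x <= u y.
Proof.
by move=> x0; rewrite le_eqVlt => /predU1P[->//|xy]; exact/ltW/(util_increasing hu).
Qed.

Lemma util_ge0 x : 0 <= x -> 0 <= u x.
Proof. by move=> x0; rewrite -(util_0 hu) util_nd. Qed.

Lemma util_concaveW x y t : 0 <= x -> 0 <= y -> 0 <= t <= 1 ->
  t * u x + (1 - t) * u y <= u (t * x + (1 - t) * y).
Proof.
move=> x0 y0 /andP[]; rewrite le_eqVlt => /predU1P[<- _|t0].
  by rewrite !mul0r !add0r subr0 !mul1r.
rewrite le_eqVlt => /predU1P[->|t1]; first by rewrite subrr !mul0r !addr0 !mul1r.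
have [->|xy] := eqVneq x y; first by rewrite -!mulrDl [t + _]addrC subrK !mul1r.
apply: ltW; apply: (util_concave hu) => //; rewrite ?t0//=; by rewrite in_itv/= andbT.
Qed.

(** Beyond [y], concavity and u(0) = 0 give u(c) / c <= u(y) / y; up to [y], monotonicity gives u(c)
    <= u(y). The right-hand side adds the two bounds. *)
Lemma util_secant y c : 0 < y -> 0 <= c -> u c <= u y + u y / y * c.
Proof.
move=> y0 c0; have uy0 := util_ge0 (ltW y0).
have [cy|yc] := leP c y.
  apply: le_trans (util_nd c0 cy) _.
  by rewrite lerDl mulr_ge0// divr_ge0// ltW.
have c0' : 0 < c by exact: lt_trans yc.
have t01 : 0 <= y / c <= 1 
  by apply/andP; split; [by apply: divr_ge0; exact: ltW|rewrite ler_pdivrMr// mul1r ltW].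
have := util_concaveW c0 (lexx 0) t01.
rewrite (util_0 hu) !mulr0 !addr0 divfK ?gt_eqF// => h.
suff : u c <= u y / y * c by lra.
by move: h; rewrite mulrAC ler_pdivrMr// mulrAC ler_pdivlMr// [u c * y]mulrC.
Qed.

(* The right-hand side is linear in c, so that it can be integrated knowing only
   the integral of the control. *)
Lemma util_increment N c d : 0 < N -> 0 <= c -> 0 <= d <= 1 ->
  d * (u (N + 1) - u N) * (1 - c / N) <= u (c + d) - u c.
Proof.
move=> N0 c0 /andP[d0 d1].
have D0 : 0 <= u (N + 1) - u N by rewrite subr_ge0; apply: util_nd; [exact: ltW|rewrite lerDl].
have [cN|Nc] := leP c N; last first.
  apply: (@le_trans _ _ 0); last by rewrite subr_ge0 util_nd// lerDl.
  rewrite mulr_ge0_le0 ?mulr_ge0// subr_le0 ler_pdivlMr// mul1r; exact: ltW.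
have s1 : d * (u (c + 1) - u c) <= u (c + d) - u c.
  have := @util_concaveW (c + 1) c d (addr_ge0 c0 ler01) c0.
  rewrite d0 d1 => /(_ isT).
  have -> : d * (c + 1) + (1 - d) * c = c + d by ring.
  lra.
have s2 : u (N + 1) - u N <= u (c + 1) - u c.
  (* [c + 1] and [N] are convex combinations of [c] and [N + 1] with exchanged weights, so the sum
     of the two concavity inequalities compares the increments. *)
  pose s := (N + 1 - c)^-1; have w0 : 0 < N + 1 - c by lra.
  have s01 : 0 <= s <= 1.
    by rewrite invr_ge0 (ltW w0)/= invf_le1//; lra.
  have N10 : 0 <= N + 1 by lra.
  have := @util_concaveW (N + 1) c s N10 c0 s01.
  have := @util_concaveW c (N + 1) s c0 N10 s01.
  have -> : s * (N + 1) + (1 - s) * c = c + 1 by rewrite /s; field; rewrite gt_eqF.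
  have -> : s * c + (1 - s) * (N + 1) = N by rewrite /s; field; rewrite gt_eqF.
  lra.
apply: (@le_trans _ _ (d * (u (N + 1) - u N))).
  rewrite ler_piMr ?mulr_ge0//; have : 0 <= c / N by rewrite divr_ge0// ltW.
  by lra.
by apply: le_trans s1; rewrite ler_wpM2l.
Qed.

Lemma util_sublinear q : 0 < q -> exists2 A, 0 <= A &
  forall c, 0 <= c -> u c <= A + q * c.
Proof.
move=> q0; have := util_derive_pinfty hu.
move=> /cvgrPdist_lt /(_ _ q0)[X0 [_ hX]].
(* The lower bound 1 keeps the mean value point positive, where [u] is differentiable. *)
pose X := Num.max 1 (X0 + 1).
have X1 : 1 <= X by rewrite le_max lexx.
have XX : X0 + 1 <= X by rewrite le_max lexx orbT.
have X00 : 0 <= X by lra.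
exists (u X) => [|c c0]; first exact: util_ge0.
have [cX|Xc] := leP c X.
  by apply: le_trans (util_nd c0 cX) _; rewrite lerDl mulr_ge0// ltW.
have [|t /andP[Xt tc] e] := @mean_value _ u (derive1 u) X c (ltW Xc).
  move=> t /andP[Xt tc]; apply: DeriveDef; last by rewrite derive1E.
  by apply: (util_derivable hu); lra.
have := hX t; rewrite sub0r normrN => /(_ _)/ltW.
have Xt' : X0 < t by lra.
move=> /(_ Xt') h; have := ler_norm (derive1 u t) => h2.
have : derive1 u t * (c - X) <= q * (c - X).
  by apply: ler_wpM2r; lra.
have : 0 <= q * X by rewrite mulr_ge0// ltW.
lra.
Qed.

(** The factor e^{eps t} of the growth condition moves to the right and becomes an integrable
    weight. The limit yields the constant 1 for large t; on [0, T] monotonicity bounds the product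
    by its value [B] at T. *)
Lemma util_growth (rho L eps : R) : 0 < rho -> 0 < L -> 0 < eps ->
  growth_condition u rho L eps ->
  exists2 C, 0 <= C & forall t, 0 <= t ->
    expR (- (rho * t)) * u (expR ((L + eps) * t)) <= C * expR (- (eps * t)).
Proof.
move=> rho0 L0 e0 /cvgrPdist_lt /(_ _ ltr01)[T0 [_ hT]].
pose T := Num.max 0 (T0 + 1).
have T00 : 0 <= T by rewrite le_max lexx.
have T01 : T0 + 1 <= T by rewrite le_max lexx orbT.
pose B := expR (eps * T) * u (expR ((L + eps) * T)).
have B0 : 0 <= B by rewrite mulr_ge0 ?expR_ge0// util_ge0// expR_ge0.
exists (1 + B) => [|t t0]; first by lra.
rewrite [expR (- (eps * t))]expRN ler_pdivlMr ?expR_gt0//.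
rewrite mulrC mulrA; have [tT|Tt] := leP t T.
  have : expR (eps * t) * u (expR ((L + eps) * t)) <= B.
    apply: ler_pM; rewrite ?expR_ge0 ?util_ge0 ?expR_ge0//.
      by rewrite ler_expR ler_wpM2l// ltW.
    by apply: util_nd; rewrite ?expR_ge0// ler_expR ler_wpM2l//; lra.
  have : expR (- (rho * t)) <= 1 by rewrite -expR0 ler_expR oppr_le0 mulr_ge0// ltW.
  have : 0 <= expR (eps * t) * u (expR ((L + eps) * t)).
    by rewrite mulr_ge0 ?expR_ge0// util_ge0// expR_ge0.
  have := expR_ge0 (- (rho * t)).
  rewrite mulrAC; nra.
have Tt' : T0 < t by lra.
have := hT t Tt'; rewrite sub0r normrN => /ltW.
have := ler_norm (expR (eps * t) * expR (- (rho * t)) * u (expR ((L + eps) * t))).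
lra.
Qed.

(** Allows the supersolution inequality to be tested with a consumption level m < c, so that
    consumption may vary slightly along a line without falling below m. *)
Lemma util_left_continuous c x : 0 < c -> (forall m, 0 <= m < c -> u m <= x) ->
  u c <= x.
Proof.
move=> c0 um; have : {for c, continuous u}.
  by apply/differentiable_continuous/derivable1_diffP; exact: (util_derivable hu).
move=> uc; apply/ler_addgt0Pr => e e0.
move/cvgrPdist_lt : uc => /(_ _ e0) /nbhs_ballP[d /= d0 hd].
pose m := Num.max 0 (c - d / 2).
have m0 : 0 <= m by rewrite le_max lexx.
have md : c - d / 2 <= m by rewrite le_max lexx orbT.
have mc : m < c by rewrite gt_max c0; lra.
have := um m; rewrite m0 mc => /(_ isT); have := hd m.
rewrite /ball/= ger0_norm; last by lra.
have cmd : c - m < d by lra.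
move=> /(_ cmd); have := ler_norm (u c - u m); lra.
Qed.

End Utility.

Section Production.
Variables (R : realType) (F : R -> R) (L : R).
Hypothesis hF : production_function F L.

Lemma prod_is_derive x : is_derive x (1 : R) F (derive1 F x).
Proof. by apply: DeriveDef; [exact: (prod_derivable hF)|rewrite derive1E]. Qed.

Lemma prod_incr x y : x < y -> F x < F y.
Proof.
move=> xy; have [t _ e] := @mean_value _ F (derive1 F) x y (ltW xy)
  (fun t _ => prod_is_derive t).
by rewrite -subr_gt0 e mulr_gt0 ?subr_gt0//; exact: (prod_derive_gt0 hF).
Qed.

Lemma prod_nd x y : x <= y -> F x <= F y.
Proof. by rewrite le_eqVlt => /predU1P[->//|/prod_incr/ltW]. Qed.

Lemma prod_ge0 x : 0 <= x -> 0 <= F x.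
Proof. by move=> x0; rewrite -(prod_0 hF) prod_nd. Qed.

Lemma prod_gt0 x : 0 < x -> 0 < F x.
Proof. by move=> x0; rewrite -(prod_0 hF) prod_incr. Qed.

Lemma prod_continuous : continuous F.
Proof. by move=> x; exact: is_derive_continuous (prod_is_derive x). Qed.

(** Past a point where F' <= a, the mean value theorem bounds the growth of F. With a = L + eps0,
    capital grows at most at the exponential rate at which the growth condition evaluates [u]. *)
Lemma prod_linear a : L < a -> exists2 M, 0 <= M &
  forall x, 0 <= x -> F x <= a * x + M.
Proof.
move=> La; have a0 : 0 < a by apply: lt_trans La; exact: (prod_L_gt0 hF).
have d0 : 0 < a - L by rewrite subr_gt0.
have := prod_derive_pinfty hF => /cvgrPdist_lt /(_ _ d0)[X0 [_ hX]].
pose X := Num.max 0 (X0 + 1).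
have X00 : 0 <= X by rewrite le_max lexx.
have X01 : X0 + 1 <= X by rewrite le_max lexx orbT.
exists (F X) => [|x x0]; first exact: prod_ge0.
have [xX|Xx] := leP x X.
  by apply: le_trans (prod_nd xX) _; rewrite lerDr mulr_ge0// ltW.
have [t /andP[Xt tx] e] := @mean_value _ F (derive1 F) X x (ltW Xx)
  (fun t _ => prod_is_derive t).
have Xt' : X0 < t by lra.
have := hX t Xt'; have := ler_norm (- (L - derive1 F t)); rewrite normrN => h1 h2.
have : derive1 F t * (x - X) <= a * (x - X).
  by apply: ler_wpM2r; lra.
have : 0 <= a * X by rewrite mulr_ge0// ltW.
lra.
Qed.

End Production.

(** * Products and compositions of absolutely continuous functions *)

Lemma ac_bounded (R : realType) (a b : R) (f : R -> R) : a <= b ->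
  absolutely_continuous a b f ->
  exists2 B, 0 <= B & forall x, a <= x <= b -> `|f x| <= B.
Proof.
move=> ab acf; have cf := ac_continuous acf.
have [c1 _ h1] := EVT_max ab cf; have [c2 _ h2] := EVT_min ab cf.
exists (`|f c1| + `|f c2|) => [|x axb]; first by rewrite addr_ge0.
have xab : x \in `[a, b] by rewrite in_itv/=.
rewrite ler_norml; have := h1 x xab; have := h2 x xab.
have := ler_norm (f c1); have := ler_norm (- f c2); rewrite normrN.
have := normr_ge0 (f c1); have := normr_ge0 (f c2).
by move=> *; apply/andP; split; lra.
Qed.

Lemma acM (R : realType) (a b : R) (f g : R -> R) : a <= b ->
  absolutely_continuous a b f -> absolutely_continuous a b g ->
  absolutely_continuous a b (fun t => f t * g t).
Proof.
move=> ab acf acg; have [B1 B10 h1] := ac_bounded ab acf.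
have [B2 B20 h2] := ac_bounded ab acg.
apply: (@ac_dominated _ a b (B1 + B2) _ f g) => // x y ax xy yb.
have -> : f y * g y - f x * g x = f y * (g y - g x) + (f y - f x) * g x by ring.
apply: le_trans (ler_normD _ _) _; rewrite !normrM.
have yB : `|f y| <= B1 by apply: h1; rewrite yb (le_trans ax xy).
have xB : `|g x| <= B2 by apply: h2; rewrite ax (le_trans xy yb).
have : `|f y| * `|g y - g x| <= B1 * `|g y - g x| by exact: ler_wpM2r.
have : `|f y - f x| * `|g x| <= `|f y - f x| * B2 by exact: ler_wpM2l.
have : 0 <= B1 * `|f y - f x| by rewrite mulr_ge0.
have : 0 <= B2 * `|g y - g x| by rewrite mulr_ge0.
lra.
Qed.

Lemma ac_comp_lipschitz (R : realType) (a b M : R) (f g : R -> R) : 0 <= M ->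
  (forall x y, a <= x <= b -> a <= y <= b -> `|f y - f x| <= M * `|g y - g x|) ->
  absolutely_continuous a b g -> absolutely_continuous a b f.
Proof.
move=> M0 fg acg; apply: (@ac_dominated _ a b M _ g g) => // x y ax xy yb.
apply: le_trans (fg _ _ _ _) _.
- by rewrite ax (le_trans xy yb).
- by rewrite yb (le_trans ax xy).
- by rewrite ler_wpM2l// lerDl.
Qed.

Lemma acD (R : realType) (a b : R) (f g : R -> R) :
  absolutely_continuous a b f -> absolutely_continuous a b g ->
  absolutely_continuous a b (fun t => f t + g t).
Proof.
move=> acf acg; apply: (@ac_dominated _ a b 1 _ f g) => // x y _ _ _.
by rewrite mul1r opprD addrACA ler_normD.
Qed.

Lemma ac_cst (R : realType) (a b k : R) : absolutely_continuous a b (fun=> k).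
Proof.
by apply: (@ac_lipschitz _ a b 0) => x y _ _ _; rewrite subrr normr0 mul0r.
Qed.

Lemma ac_derive (R : realType) (a b M : R) (f df : R -> R) :
  (forall t, a <= t <= b -> is_derive t (1 : R) f (df t)) ->
  (forall t, a <= t <= b -> `|df t| <= M) ->
  absolutely_continuous a b f.
Proof.
move=> fdf dfM; apply: (@ac_lipschitz _ a b M) => x y ax xy yb.
have [t /andP[xt ty]|c /andP[xc cy] ->] := @mean_value _ f df x y xy.
  by apply: fdf; rewrite (le_trans ax xt) (le_trans ty yb).
rewrite normrM [`|y - x|]ger0_norm ?subr_ge0// ler_wpM2r ?subr_ge0//.
by apply: dfM; rewrite (le_trans ax xc) (le_trans cy yb).
Qed.

Lemma is_derive_expRN (R : realType) (k t : R) :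
  is_derive t (1 : R) (fun s => expR (- (k * s))) (- (k * expR (- (k * t)))).
Proof.
have := is_derive_expRM (- k) t.
rewrite (_ : (fun s => expR (- k * s)) = (fun s => expR (- (k * s)))).
  by rewrite mulNr mulrN mulrC.
by apply/funext => s; rewrite mulNr.
Qed.

Lemma ac_expRN (R : realType) (T k : R) : 0 <= k ->
  absolutely_continuous 0 T (fun s => expR (- (k * s))).
Proof.
move=> k0; apply: (@ac_derive _ 0 T k _ (fun t => - (k * expR (- (k * t))))).
  by move=> t _; exact: is_derive_expRN.
move=> t /andP[t0 _]; rewrite normrN ger0_norm ?mulr_ge0 ?expR_ge0//.
by rewrite ler_piMr// -expR0 ler_expR oppr_le0 mulr_ge0.
Qed.

Lemma ge0_integral_halfline_le (R : realType) (f : R -> R) (M : \bar R) :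
  measurable_fun `[(0 : R), +oo[ f -> (forall t, 0 <= f t) ->
  (forall T, 0 <= T -> (\int[@lebesgue_measure R]_(t in `[0%R, T]) (f t)%:E <= M)%E) ->
  (\int[@lebesgue_measure R]_(t in `[0%R, +oo[) (f t)%:E <= M)%E.
Proof.
move=> mf f0 fM.
pose D n : set R := `[0, n.+1%:R]%classic.
have Dsub n : D n `<=` `[(0 : R), +oo[ by exact: subset_itvl.
have ndD : nondecreasing_seq D.
  by move=> m n mn; rewrite subsetEset; apply: subset_itvl; rewrite bnd_simp ler_nat.
have mfD n : measurable_fun (D n) (fun t => (f t)%:E).
  by apply/measurable_EFinP; apply: measurable_funS mf.
have H : (\int[@lebesgue_measure R]_(t in D n) (f t)%:E)%E @[n --> \oo] -->
    (\int[@lebesgue_measure R]_(t in `[0%R, +oo[) (f t)%:E)%E.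
  rewrite itv0y_bigcup0S; apply: ge0_nondecreasing_set_cvg_integral.
  - exact: ndD.
  - by move=> n; exact: measurable_itv.
  - exact: mfD.
  - by move=> n t _; rewrite lee_fin.
rewrite -(cvg_lim _ H)//.
apply: lime_le; first by apply/cvg_ex; eexists; exact: H.
by apply: nearW => n; apply: fM; exact: ler0n.
Qed.

(** * Controls and payoffs *)

(* As u 0 = 0, truncating c at 0 has the same effect as removing the set c < 0
   from the domain of integration. *)
Definition payoff (R : realType) (u : R -> R) (rho : R) (c : R -> R) (t : R) : R :=
  expR (- (rho * t)) * u (Num.max 0 (c t)).

Section Control.
Variables (R : realType) (F u : R -> R) (L rho eps0 : R).
Hypothesis hF : production_function F L.
Hypothesis hrho : 0 < rho.
Hypothesis hu : utility_function u.
Hypothesis heps0 : 0 < eps0.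
Hypothesis hgrowth : growth_condition u rho L eps0.

Local Notation mu := (@lebesgue_measure R).
Implicit Types (c : R -> R) (T t : R).

Lemma payoff_ge0 c t : 0 <= payoff u rho c t.
Proof. by rewrite mulr_ge0 ?expR_ge0// (util_ge0 hu)// le_max lexx. Qed.

Lemma utility_functionalE c :
  utility_functional u rho c = (\int[mu]_(t in `[0%R, +oo[) (payoff u rho c t)%:E)%E.
Proof.
rewrite /utility_functional integral_mkcondr; apply: eq_integral => t _.
rewrite patchE /payoff; case: ifPn => [|].
  by rewrite inE/= => c0; rewrite (max_idPr c0).
rewrite notin_setE/= => /negP; rewrite -ltNge => /ltW c0.
by rewrite (max_idPl c0) (util_0 hu) mulr0.
Qed.

Lemma L1_loc_measurable c : L1_loc c -> measurable_fun `[(0 : R), +oo[ c.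
Proof.
move=> Lc; rewrite itv0y_bigcup0S; apply/measurable_fun_bigcup => // n.
by have /measurable_int/measurable_EFinP := Lc n.+1%:R (ler0n _ _).
Qed.

Lemma measurable_payoff c : L1_loc c -> measurable_fun `[(0 : R), +oo[ (payoff u rho c).
Proof.
move=> Lc; apply: measurable_funM.
  apply: measurableT_comp; first exact: measurable_expR.
  by apply: measurable_funN; apply: measurable_funM.
(* Truncation makes the utility nondecreasing on the whole line, hence measurable, whatever the
   values of [u] at negative numbers. *)
rewrite [X in measurable_fun _ X](_ : _ = (fun x => u (Num.max 0 x)) \o c)//.
apply: measurableT_comp.
  apply: nondecreasing_measurable => // x y xy.
  apply: (util_nd hu); first by rewrite le_max lexx.
  by rewrite ge_max !le_max lexx xy orbT.
exact: L1_loc_measurable.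
Qed.

Lemma measurable_EFin_payoff c (D : set R) : L1_loc c -> measurable D ->
  D `<=` `[(0 : R), +oo[ -> measurable_fun D (fun t => (payoff u rho c t)%:E).
Proof.
move=> Lc mD D0; apply/measurable_EFinP; apply: measurable_funS (measurable_payoff Lc) => //.
Qed.

(** Null sets are handled here: [g] has to be differentiated only at times where the control is
    nonnegative and the state equation holds. *)
Lemma trajectory_integral_le k0 c k T (h g : R -> R) : 0 <= T ->
  admissible F k0 c -> state_solution F k0 c k ->
  measurable_fun `[(0 : R), T] h -> (forall t, 0 <= t <= T -> 0 <= h t) ->
  absolutely_continuous 0 T g ->
  (forall t, 0 <= t <= T -> 0 <= c t -> is_derive t (1 : R) k (F (k t) - c t) ->
    exists2 dg, h t <= dg & is_derive t (1 : R) g dg) ->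
  (\int[mu]_(t in `[0%R, T]) (h t)%:E <= (g T - g 0)%:E)%E.
Proof.
move=> T0 [_ c0 _] [_ _ dk] mh h0 acg hg; apply: ge0_integral_le_ac => //.
apply: (ae_imply2 c0 dk) => t ct kt /[dup] tT /andP[t0 _].
by apply: hg => //; [exact: ct|exact: kt].
Qed.

(** Where F(k) <= a k + M, this derivative is at most -e^{-at} c(t), the shift M / a absorbing M: a
    Gronwall estimate that keeps track of consumption. *)
Lemma discounted_capital a M k c t : 
  is_derive t (1 : R) k (F (k t) - c t) ->
  is_derive t (1 : R) (fun s => expR (- (a * s)) * (k s + M / a))
    (expR (- (a * t)) * (F (k t) - c t) - a * expR (- (a * t)) * (k t + M / a)).
Proof.
move=> dk; have dk' := is_derive_addf dk (is_derive_cst (M / a) t 1).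
have := is_derive_mulf (is_derive_expRN a t) dk'.
by rewrite addr0 mulrN [_ * (a * _)]mulrC.
Qed.

Lemma ac_discounted_capital a M k0 k c T : 0 <= a -> 0 <= T ->
  state_solution F k0 c k ->
  absolutely_continuous 0 T (fun s => expR (- (a * s)) * (k s + M / a)).
Proof.
move=> a0 T0 [_ ack _]; apply: acM => //; first exact: ac_expRN.
by apply: acD; [exact: ack|exact: ac_cst].
Qed.

Lemma running_bound : exists A B, [/\ 0 <= A, 0 <= B & forall k0 c T, 0 <= k0 -> 0 <= T ->
  admissible F k0 c ->
  (\int[mu]_(t in `[0%R, T]) (payoff u rho c t)%:E <= (A + B * k0)%:E)%E].
Proof.
have L0 := prod_L_gt0 hF.
have [C C0 hC] := util_growth hu hrho L0 heps0 hgrowth.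
set a := L + eps0 in hC; have a0 : 0 < a by rewrite addr_gt0.
have La : L < a by rewrite ltrDl.
have [M M0 hM] := prod_linear hF La.
have Ma0 : 0 <= M / a by rewrite divr_ge0// ltW.
exists (C / eps0 + C * (M / a)), C; split => //.
  by rewrite addr_ge0 ?mulr_ge0 ?invr_ge0// ltW.
move=> k0 c T k00 T0 adm; have [Lc _ [k solk kge0]] := adm.
(* The first term has derivative C e^{-eps0 t} and the second at least C e^{-at} c(t); together they
   dominate the payoff. As g(T) <= 0, the bound is -g(0), affine in k0 and independent of T. *)
pose g t := (- (C / eps0)) * expR (- (eps0 * t)) - C * (expR (- (a * t)) * (k t + M / a)).
have mp : measurable_fun `[0, T] (payoff u rho c).
  apply: measurable_funS (measurable_payoff Lc) => //; exact: subset_itvl.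
have acg : absolutely_continuous 0 T g.
  apply: acB.
    apply: acM => //; [exact: ac_cst|exact/ac_expRN/ltW].
  apply: acM => //; [exact: ac_cst|exact: (ac_discounted_capital _ (ltW a0) _ solk)].
have := @trajectory_integral_le k0 c k T _ g T0 adm solk mp.
have g0 : g 0 = - (C / eps0 + C * (M / a) + C * k0).
  by have [k0E _ _] := solk; rewrite /g !mulr0 oppr0 expR0 k0E; ring.
have gT : g T <= 0.
  have : 0 <= C * (expR (- (a * T)) * (k T + M / a)).
    by rewrite !mulr_ge0 ?expR_ge0// addr_ge0// kge0.
  have : 0 <= C / eps0 * expR (- (eps0 * T)).
    by rewrite !mulr_ge0 ?expR_ge0// invr_ge0 ltW.
  by rewrite /g; lra.
move=> H; apply: le_trans (H _ acg _) _.
- by move=> t _; exact: payoff_ge0.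
- move=> t /andP[t0 tT] ct kt.
  have d1 := is_derive_scalef (- (C / eps0)) (is_derive_expRN eps0 t).
  have d2 := is_derive_scalef C (discounted_capital a M kt).
  eexists; last exact: (is_derive_subf d1 d2).
  rewrite /payoff (max_idPr ct).
  set Ea := expR (- (a * t)); set Ee := expR (- (eps0 * t)).
  have Ea0 : 0 <= Ea := expR_ge0 _; have Ee0 : 0 <= Ee := expR_ge0 _.
  have Ee1 : Ee <= 1 by rewrite -expR0 ler_expR oppr_le0 mulr_ge0// ltW.
  have y0 : 0 < expR (a * t) := expR_gt0 _.
  have := util_secant hu y0 ct; have := hC t t0; rewrite -/Ee.
  set U := u (expR (a * t)) => hU hc.
  have EaV : Ea = (expR (a * t))^-1 by rewrite /Ea expRN.
  rewrite -EaV in hc.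
  have h1 : expR (- (rho * t)) * u (c t) <= expR (- (rho * t)) * U * (1 + Ea * c t).
    rewrite -mulrA ler_wpM2l ?expR_ge0//; apply: le_trans hc _.
    by rewrite le_eqVlt; apply/orP; left; apply/eqP; ring.
  have p1 : 0 <= Ea * c t by rewrite mulr_ge0.
  have h2 : expR (- (rho * t)) * U * (1 + Ea * c t) <= C * Ee * (1 + Ea * c t).
    by apply: ler_wpM2r => //; lra.
  have h3 : C * Ee * (Ea * c t) <= C * (Ea * c t).
    by apply: ler_wpM2r => //; rewrite ler_piMr.
  have h4 : C * Ea * F (k t) <= C * Ea * (a * k t + M).
    by rewrite ler_wpM2l ?mulr_ge0// hM// kge0.
  have -> : - (C / eps0) * - (eps0 * Ee) = C * Ee by field; rewrite gt_eqF.
  have -> : C * (Ea * (F (k t) - c t) - a * Ea * (k t + M / a)) =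
     C * Ea * F (k t) - C * (Ea * c t) - C * Ea * (a * k t + M).
    by field; rewrite gt_eqF.
  lra.
- by rewrite lee_fin g0; lra.
Qed.

(** The factor e^a undoes the discount on the unit interval, where e^a e^{-at} >= 1. The bound is
    uniform over the controls, as [value_increment] requires. *)
Lemma control_bound : exists A B, [/\ 0 <= A, 0 <= B & forall k0 c, 0 <= k0 ->
  admissible F k0 c ->
  (\int[mu]_(t in `[0%R, 1%R]) (Num.max 0 (c t))%:E <= (A + B * k0)%:E)%E].
Proof.
have L0 := prod_L_gt0 hF.
pose a := L + eps0; have a0 : 0 < a by rewrite addr_gt0.
have La : L < a by rewrite ltrDl.
have [M M0 hM] := prod_linear hF La.
have Ma0 : 0 <= M / a by rewrite divr_ge0// ltW.
have E0 : 0 <= expR a := expR_ge0 _.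
exists (expR a * (M / a)), (expR a); split => //; first by rewrite mulr_ge0.
move=> k0 c k00 adm; have [Lc _ [k solk kge0]] := adm.
pose g t := - expR a * (expR (- (a * t)) * (k t + M / a)).
have mp : measurable_fun `[(0 : R), 1] (fun t => Num.max 0 (c t)).
  apply: measurable_maxr => //.
  apply: measurable_funS (L1_loc_measurable Lc) => //; exact: subset_itvl.
have acg : absolutely_continuous 0 1 g.
  apply: acM => //; [exact: ac_cst|exact: (ac_discounted_capital _ (ltW a0) _ solk)].
have := @trajectory_integral_le k0 c k 1 _ g ler01 adm solk mp.
have g0 : g 0 = - (expR a * (M / a) + expR a * k0).
  by have [k0E _ _] := solk; rewrite /g !mulr0 oppr0 expR0 k0E; ring.
have gT : g 1 <= 0.
  have : 0 <= expR a * (expR (- (a * 1)) * (k 1 + M / a)).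
    by rewrite !mulr_ge0 ?expR_ge0// addr_ge0// kge0.
  by rewrite /g; lra.
move=> H; apply: le_trans (H _ acg _) _.
- by move=> t _; rewrite le_max lexx.
- move=> t /andP[t0 tT] ct kt.
  eexists; last exact: (is_derive_scalef (- expR a) (discounted_capital a M kt)).
  rewrite (max_idPr ct).
  set Ea := expR (- (a * t)).
  have Ea0 : 0 <= Ea := expR_ge0 _.
  have h4 : expR a * Ea * F (k t) <= expR a * Ea * (a * k t + M).
    by rewrite ler_wpM2l ?mulr_ge0// hM// kge0.
  have EE : 1 <= expR a * Ea.
    rewrite /Ea -expRD -expR0 ler_expR subr_ge0 ler_piMr//; exact: ltW.
  have : c t <= expR a * Ea * c t by rewrite ler_peMl.
  have -> : - expR a * (Ea * (F (k t) - c t) - a * Ea * (k t + M / a)) =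
     - (expR a * Ea * F (k t)) + expR a * Ea * c t + expR a * Ea * (a * k t + M).
    by field; rewrite gt_eqF.
  lra.
- by rewrite lee_fin g0; lra.
Qed.

Lemma utility_functional_bound : exists A B, [/\ 0 <= A, 0 <= B & forall k0 c, 0 <= k0 ->
  admissible F k0 c -> (utility_functional u rho c <= (A + B * k0)%:E)%E].
Proof.
have [A [B [A0 B0 hAB]]] := running_bound; exists A, B; split => // k0 c k00 adm.
have [Lc _ _] := adm.
rewrite utility_functionalE; apply: ge0_integral_halfline_le.
- exact: measurable_payoff.
- by move=> t; exact: payoff_ge0.
- by move=> T T0; exact: hAB.
Qed.

End Control.

Lemma is_derive_affine (R : realType) (a v t : R) :
  is_derive t (1 : R) (fun s => a + v * s) v.
Proof.
by have := is_derive_addf (is_derive_cst a t (1 : R)) (is_derive_scale v t); rewrite add0r.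
Qed.

Lemma is_derive_shift (R : realType) (f : R -> R) (s t a : R) :
  is_derive (t + s) (1 : R) f a -> is_derive t (1 : R) (fun x => f (x + s)) a.
Proof.
move=> fa; have h := is_derive_addf (@is_derive_id R R t 1) (is_derive_cst s t (1 : R)).
by have := @is_derive_compf R f (fun x => x + s) t a _ fa h; rewrite addr0 mulr1.
Qed.

Lemma integrable_shift (R : realType) (s : R) (D : set R) (f : R -> R) :
  measurable D -> (@lebesgue_measure R).-integrable D (EFin \o f) ->
  (@lebesgue_measure R).-integrable ((fun t => t + s) @^-1` D)
    (EFin \o (fun t => f (t + s))).
Proof.
move=> mD /integrableP[mf foo].
have mpre : measurable ((fun t => t + s) @^-1` D).
  by rewrite -[X in measurable X]setTI; exact: measurable_shift.
apply/integrableP; split.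
  apply: (measurable_comp (F := D)) mf _ => //; first by move=> _ [t Dt <-].
  by apply: measurable_funTS; exact: measurable_shift.
move: foo; rewrite (ge0_integral_shift s)//; last exact: measurableT_comp.
Qed.

Lemma integrable_setU (R : realType) (A B : set R) (f : R -> \bar R) :
  measurable A -> measurable B -> [disjoint A & B] ->
  (@lebesgue_measure R).-integrable A f -> (@lebesgue_measure R).-integrable B f ->
  (@lebesgue_measure R).-integrable (A `|` B) f.
Proof.
move=> mA mB AB /integrableP[mfA fA] /integrableP[mfB fB].
have mf : measurable_fun (A `|` B) f by apply/measurable_funU.
apply/integrableP; split => //.
rewrite ge0_integral_setU//; last exact: measurableT_comp.
by rewrite lte_add_pinfty.
Qed.

(** * The value function and dynamic programming *)

Definition value (R : realType) (F u : R -> R) (rho x : R) : R :=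
  fine (value_function F u rho x).

Section Value.
Variables (R : realType) (F u : R -> R) (L rho eps0 : R).
Hypothesis hF : production_function F L.
Hypothesis hrho : 0 < rho.
Hypothesis hu : utility_function u.
Hypothesis heps0 : 0 < eps0.
Hypothesis hgrowth : growth_condition u rho L eps0.

Local Notation mu := (@lebesgue_measure R).
Local Notation V := (value F u rho).
Local Notation U := (utility_functional u rho).
Implicit Types (c : R -> R) (T t : R).

Lemma L1_loc_continuous (f : R -> R) :
  (forall T, 0 <= T -> {within `[0, T], continuous f}) -> L1_loc f.
Proof.
move=> cf T T0; apply: continuous_compact_integrable; first exact: segment_compact.
exact: cf.
Qed.

Lemma constant_admissible (k0 : R) : 0 <= k0 -> admissible F k0 (fun=> F k0).
Proof.
move=> k00; split.
- by apply: L1_loc_continuous => T _; apply: continuous_subspaceT => x; exact: cvg_cst.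
- by apply: aeW => t _; exact: (prod_ge0 hF).
- exists (fun=> k0) => //; split => //.
    by move=> T _; exact: ac_cst.
  by apply: aeW => t _; rewrite subrr; exact: is_derive_cst.
Qed.

Lemma utility_functional_ge0 c : (0 <= U c)%E.
Proof.
by rewrite (utility_functionalE _ hu); apply: integral_ge0 => t _; rewrite lee_fin payoff_ge0.
Qed.

Lemma value_function_ge0 (k0 : R) : 0 <= k0 -> (0 <= value_function F u rho k0)%E.
Proof.
move=> k00; apply: le_trans (utility_functional_ge0 (fun=> F k0)) _.
by apply: ereal_sup_ubound; exists (fun=> F k0) => //; exact: constant_admissible.
Qed.

Lemma value_function_fin_num (k0 : R) : 0 <= k0 -> value_function F u rho k0 \is a fin_num.
Proof.
move=> k00; rewrite ge0_fin_numE; last exact: value_function_ge0.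
have [A [B [A0 B0 h]]] := utility_functional_bound hF hrho hu heps0 hgrowth.
apply: le_lt_trans (ltry (A + B * k0)); apply: ge_ereal_sup => _ [c adm <-].
exact: h.
Qed.

Lemma value_ge0 (k0 : R) : 0 <= k0 -> 0 <= V k0.
Proof. by move=> k00; apply: fine_ge0; exact: value_function_ge0. Qed.

Lemma value_ubound (k0 : R) c : 0 <= k0 -> admissible F k0 c -> (U c <= (V k0)%:E)%E.
Proof.
move=> k00 adm; rewrite /value fineK; last exact: value_function_fin_num.
by apply: ereal_sup_ubound; exists c.
Qed.

Lemma value_le (k0 x : R) : 0 <= k0 ->
  (forall c, admissible F k0 c -> (U c <= x%:E)%E) -> V k0 <= x.
Proof.
move=> k00 h; rewrite -lee_fin /value fineK; last exact: value_function_fin_num.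
by apply: ge_ereal_sup => _ [c adm <-]; exact: h.
Qed.

Lemma value_adherent (k0 e : R) : 0 <= k0 -> 0 < e ->
  exists2 c, admissible F k0 c & ((V k0 - e)%:E < U c)%E.
Proof.
move=> k00 e0; apply: contrapT => H.
have : V k0 <= V k0 - e.
  apply: value_le => // c adm; rewrite leNgt; apply/negP => ?.
  by apply: H; exists c.
by lra.
Qed.

(** The trajectory is a parameter because the new initial state is one of its values. *)
Lemma admissible_shift (k0 tau : R) c k : 0 <= tau -> L1_loc c ->
  {ae mu, forall t, 0 <= t -> 0 <= c t} -> state_solution F k0 c k ->
  (forall t, 0 <= t -> 0 <= k t) ->
  admissible F (k tau) (fun t => c (t + tau)).
Proof.
move=> tau0 Lc c0 [k0E ack dk] kge0; split.
- move=> T T0.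
  have := integrable_shift tau (measurable_itv `[0, T + tau]) (Lc _ (addr_ge0 T0 tau0)).
  apply: integrableS => //.
    by rewrite -[X in measurable X]setTI; exact: measurable_shift.
  by move=> t /=; rewrite !in_itv/= lerD2r => /andP[t0 ->]; rewrite addr_ge0.
- by apply: (ae_imply (ae_shift tau c0)) => t + t0; apply; rewrite addr_ge0.
- exists (fun t => k (t + tau)); last by move=> t t0; apply: kge0; rewrite addr_ge0.
  split; first by rewrite add0r.
    move=> T T0; apply: (@ac_comp_nondecreasing _ 0 T 0 (T + tau) (fun t => t + tau)).
      by move=> x y x0 xy yT; split; lra.
    by apply: ack; rewrite addr_ge0.
  apply: (ae_imply (ae_shift tau dk)) => t + t0 => /(_ (addr_ge0 t0 tau0)).
  exact: is_derive_shift.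
Qed.

Lemma utility_functional_split (tau : R) c : 0 <= tau -> L1_loc c ->
  L1_loc (fun t => c (t + tau)) ->
  (U c = \int[mu]_(t in `[0%R, tau]) (payoff u rho c t)%:E +
    (expR (- (rho * tau)))%:E * U (fun t => c (t + tau)%R))%E.
Proof.
move=> tau0 Lc Lcs; rewrite !(utility_functionalE _ hu).
have mp D : measurable D -> D `<=` `[(0 : R), +oo[ ->
    measurable_fun D (fun t => (payoff u rho c t)%:E).
  exact: measurable_EFin_payoff.
rewrite [in LHS](_ : `[0%R, +oo[%classic = `[0%R, tau[ `|` `[tau, +oo[); last first.
  by rewrite -itv_bndbnd_setU// bnd_simp.
have p0 t : (0 <= (payoff u rho c t)%:E)%E by rewrite lee_fin payoff_ge0.
rewrite ge0_integral_setU//; last 2 first.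
- apply: mp; first exact: measurableU.
  by move=> t []; rewrite /= !in_itv/= ?andbT; [case/andP|exact: le_trans].
- apply/disj_setPS => t [] /=; rewrite !in_itv/= => /andP[_ ?]; lra.
congr (_ + _)%E.
  rewrite integral_itv_bndo_bndc//; apply: mp => //.
  exact: subset_itvl.
rewrite -ge0_integralZl//; last 2 first.
- exact: measurable_EFin_payoff.
- by move=> t _; rewrite lee_fin payoff_ge0.
rewrite (ge0_integral_shift tau)//; last first.
  by apply: mp => // t /=; rewrite !in_itv/= !andbT; exact: le_trans.
rewrite (_ : _ @^-1` _ = `[0%R, +oo[%classic); last first.
  by apply/seteqP; split => t /=; rewrite !in_itv/= !andbT lerDr.
apply: eq_integral => t _; rewrite -EFinM; congr EFin.
by rewrite /payoff mulrA -expRD; congr (expR _ * _); ring.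
Qed.

Lemma dpp_upper (k0 tau : R) c k : 0 <= tau -> L1_loc c ->
  {ae mu, forall t, 0 <= t -> 0 <= c t} -> state_solution F k0 c k ->
  (forall t, 0 <= t -> 0 <= k t) ->
  (U c <= \int[mu]_(t in `[0%R, tau]) (payoff u rho c t)%:E +
    (expR (- (rho * tau)) * V (k tau))%:E)%E.
Proof.
move=> tau0 Lc c0 sol kge0; have adm := admissible_shift tau0 Lc c0 sol kge0.
have [Lcs _ _] := adm.
rewrite (utility_functional_split tau0 Lc Lcs) leeD2l// EFinM lee_pmul2l//.
- by apply: value_ubound => //; exact: kge0.
- by rewrite lte_fin expR_gt0.
Qed.

Lemma dpp_lower (k0 v tau m : R) : 0 <= k0 -> 0 <= tau -> 0 <= m ->
  (forall t, 0 <= t <= tau -> 0 <= k0 + v * t) ->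
  (forall t, 0 <= t <= tau -> m <= F (k0 + v * t) - v) ->
  expR (- (rho * tau)) * (tau * u m + V (k0 + v * tau)) <= V k0.
Proof.
move=> k00 tau0 m0 kge0 mF.
set k1 := k0 + v * tau; have k10 : 0 <= k1 by apply: kge0; rewrite tau0 lexx.
(* Solving for [V k1] turns the claim into an upper bound for a supremum: an arbitrary control from
   [k1] is glued after the line, and no nearly optimal one has to be chosen. *)
rewrite mulrDr -lerBrDl mulrC -ler_pdivlMr ?expR_gt0//.
apply: value_le => // c [Lc c0 [k [k0E ack dk] kpos]].
pose cc t := if t < tau then F (k0 + v * t) - v else c (t - tau).
(* At each time one of the two clocks is frozen, so a single formula describes the glued path and
   inherits absolute continuity from its pieces; the last term vanishes up to [tau] because k(0) =
   k1. *)
pose kk t := k0 + v * Num.min t tau + (k (Num.max (t - tau) 0) - k1).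
have ccE t : t < tau -> cc t = F (k0 + v * t) - v by move=> h; rewrite /cc h.
have ccE' t : tau <= t -> cc t = c (t - tau) by move=> h; rewrite /cc ltNge h.
have kkE t : t <= tau -> kk t = k0 + v * t.
  by move=> h; rewrite /kk (min_idPl h) max_r ?subr_le0// k0E subrr addr0.
have kkE' t : tau <= t -> kk t = k (t - tau).
  by move=> h; rewrite /kk (min_idPr h) max_l ?subr_ge0// addrC subrK.
have contF : continuous (fun t => F (k0 + v * t) - v).
  move=> t; have h := is_derive_compf (prod_is_derive hF _) (is_derive_affine k0 v t).
  exact: is_derive_continuous (is_derive_subf h (is_derive_cst v t 1)).
have L1F : L1_loc (fun t => F (k0 + v * t) - v).
  by apply: L1_loc_continuous => T _; exact: continuous_subspaceT.
have Lcc : L1_loc cc.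
  move=> T T0; have [Ttau|tauT] := ltP T tau.
    apply: eq_integrable (L1F T T0) => // t; rewrite inE/= in_itv/= => /andP[_ tT].
    by rewrite ccE//; exact: le_lt_trans Ttau.
  rewrite (_ : `[0%R, T]%classic = `[0%R, tau[ `|` `[tau, T]); last first.
    by rewrite -itv_bndbnd_setU// bnd_simp.
  apply: integrable_setU => //.
  - apply/disj_setPS => t [] /=; rewrite !in_itv/= => /andP[_ ?]; lra.
  - have L1F' : mu.-integrable `[0%R, tau[ (EFin \o (fun t => F (k0 + v * t) - v)).
      by apply: integrableS (L1F tau tau0) => //; apply: subset_itvl; rewrite bnd_simp.
    apply: eq_integrable L1F' => // t; rewrite inE/= in_itv/= => /andP[_ tT].
    by rewrite ccE.
  - have T'0 : 0 <= T - tau by rewrite subr_ge0.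
    have := integrable_shift (- tau) (measurable_itv `[0, T - tau]) (Lc _ T'0).
    rewrite (_ : _ @^-1` _ = `[tau, T]%classic); last first.
      by apply/seteqP; split => t /=; rewrite !in_itv/= subr_ge0 lerD2r.
    apply: eq_integrable => // t; rewrite inE/= in_itv/= => /andP[tT _].
    by rewrite /= ccE'.
have admc : admissible F k0 cc.
  split => //.
  - apply: (ae_imply (ae_shift (- tau) c0)) => t ct t0; have [h|h] := ltP t tau.
      by rewrite ccE// (le_trans m0)// mF// t0 ltW.
    by rewrite ccE'// ct// subr_ge0.
  - exists kk => [|t t0]; last first.
      have [h|h] := leP t tau; first by rewrite kkE// kge0// t0.
      by rewrite kkE' ?kpos ?subr_ge0// ltW.
    split; first by rewrite kkE// mulr0 addr0.
      move=> T T0.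
      have acs : absolutely_continuous 0 T (k \o (fun t => Num.max (t - tau) 0)).
        apply: (@ac_comp_nondecreasing _ 0 T 0 T (fun t => Num.max (t - tau) 0)); last exact: ack.
        move=> x y x0 xy yT; split.
        * by rewrite le_max lexx orbT.
        * by rewrite ge_max !le_max lerD2r xy lexx orbT.
        * by rewrite ge_max T0 andbT; lra.
        * by case: (leP (y - tau) 0) => h1; case: (leP (x - tau) 0) => h2; lra.
      apply: (@ac_dominated _ 0 T (`|v| + 1) _ id _ (@ac_id _ _ _) acs) => x y x0 xy yT.
      rewrite /kk /=.
      set a := k (Num.max (y - tau) 0); set b := k (Num.max (x - tau) 0).
      have -> : k0 + v * Num.min y tau + (a - k1) - (k0 + v * Num.min x tau + (b - k1)) =
        v * (Num.min y tau - Num.min x tau) + (a - b) by ring.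
      apply: le_trans (ler_normD _ _) _; rewrite normrM mulrDr.
      apply: lerD; last by rewrite ler_peMl// lerDr.
      have hmin : `|Num.min y tau - Num.min x tau| <= `|y - x|.
        rewrite [leRHS]ger0_norm ?subr_ge0// ler_norml.
        by case: (leP y tau) => h1; case: (leP x tau) => h2; apply/andP; split; lra.
      apply: (@le_trans _ _ (`|v| * `|y - x|)); first by rewrite ler_wpM2l.
      by rewrite ler_wpM2r// lerDl.
    (* The gluing time may be a kink of the path and is discarded as a null set. *)
    have aeN : {ae mu, forall t, t <> tau}.
      exists [set tau]; split => //; first exact: lebesgue_measure_set1.
      by move=> t /= /contrapT.
    apply: (ae_imply2 aeN (ae_shift (- tau) dk)) => t ttau dkt t0.
    have [h|h|//] := ltgtP t tau.
      rewrite (kkE _ (ltW h)) ccE//.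
      rewrite (_ : F (k0 + v * t) - _ = v); last by ring.
      apply: (@is_derive_locally _ (fun s => k0 + v * s) kk t v (tau - t)).
      + by rewrite subr_gt0.
      + by move=> s /(le_lt_trans (ler_norm _)) st; rewrite kkE//; lra.
      + exact: is_derive_affine.
    rewrite (kkE' _ (ltW h)) ccE'; last exact: ltW.
    apply: (@is_derive_locally _ (fun s => k (s - tau)) kk t _ (t - tau)).
    + by rewrite subr_gt0.
    + move=> s; rewrite distrC => /(le_lt_trans (ler_norm _)) st; rewrite kkE'//; lra.
    + have tt0 : 0 <= t - tau by rewrite subr_ge0 ltW.
      exact: is_derive_shift (dkt tt0).
have shiftE : U (fun t => cc (t + tau)) = U c.
  rewrite !(utility_functionalE _ hu); apply: eq_integral => t; rewrite inE/= in_itv/= andbT => t0.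
  by rewrite /payoff ccE' ?lerDr// addrK.
have Lcs : L1_loc (fun t => cc (t + tau)).
  move=> T T0; apply: eq_integrable (Lc _ T0) => // t; rewrite inE/= in_itv/= => /andP[t0 _].
  by rewrite /= ccE' ?lerDr// addrK.
have := value_ubound k00 admc.
rewrite (utility_functional_split tau0 Lcc Lcs) shiftE => H.
have int_ge : ((expR (- (rho * tau)) * (tau * u m))%:E <=
    \int[mu]_(t in `[0%R, tau]) (payoff u rho cc t)%:E)%E.
  (* The endpoint is dropped because [cc tau] is already [c 0], which need not be at least [m]. *)
  rewrite -(@integral_itv_bndo_bndc _ (BLeft 0) tau); last first.
    by apply: measurable_EFin_payoff => //; exact: subset_itvl.
  apply: (@le_trans _ _ (\int[mu]_(t in `[0%R, tau[) (expR (- (rho * tau)) * u m)%:E)%E).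
    rewrite integral_cst//= lebesgue_measure_itv/= lte_fin; case: ltP => h.
      by rewrite -EFinD -EFinM lee_fin subr0 le_eqVlt; apply/orP; left; apply/eqP; ring.
    have -> : tau = 0 by apply/eqP; rewrite eq_le tau0 h.
    by rewrite mul0r mulr0 mule0.
  apply: ge0_le_integral => //.
  - by move=> t _; rewrite lee_fin mulr_ge0 ?expR_ge0// (util_ge0 hu).
  - by apply: measurable_EFin_payoff => //; exact: subset_itvl.
  - move=> t /=; rewrite in_itv/= => /andP[t0 tt]; rewrite lee_fin /payoff ccE//.
    have mt : m <= F (k0 + v * t) - v by apply: mF; rewrite t0 ltW.
    rewrite (max_idPr (le_trans m0 mt)); apply: ler_pM; rewrite ?expR_ge0 ?(util_ge0 hu)//.
      by rewrite ler_expR lerN2 ler_wpM2l// ltW.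
    exact: (util_nd hu).
have e0 : (0 < (expR (- (rho * tau)))%:E)%E by rewrite lte_fin expR_gt0.
have H2 := le_trans (leeD int_ge (lexx _)) H.
have Ufin : U c \is a fin_num.
  rewrite ge0_fin_numE ?utility_functional_ge0//; apply: le_lt_trans (ltry (V k1)).
  by apply: value_ubound => //; split => //; exists k.
move: H2; rewrite -(fineK Ufin) -EFinM -EFinD !lee_fin => H2.
by rewrite ler_pdivlMr ?expR_gt0// mulrC; lra.
Qed.

End Value.

(** * A uniform lower bound for the increments of the value function *)

Lemma within_continuous_postcomp (R : realType) (A : set R) (f g : R -> R) :
  {within A, continuous g} -> continuous f -> {within A, continuous (f \o g)}.
Proof.
move=> cg cf x.
exact: (@continuous_comp (subspace A) R R g f x (cg x) (cf (g x))).
Qed.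

Section Increment.
Variables (R : realType) (F u : R -> R) (L rho eps0 : R).
Hypothesis hF : production_function F L.
Hypothesis hrho : 0 < rho.
Hypothesis hu : utility_function u.
Hypothesis heps0 : 0 < eps0.
Hypothesis hgrowth : growth_condition u rho L eps0.

Local Notation mu := (@lebesgue_measure R).
Local Notation V := (value F u rho).
Local Notation U := (utility_functional u rho).
Implicit Types (c : R -> R) (T t : R).

Lemma payoff_le c d t : c t <= d t -> payoff u rho c t <= payoff u rho d t.
Proof.
move=> cd; rewrite ler_wpM2l ?expR_ge0//; apply: (util_nd hu).
  by rewrite le_max lexx.
by rewrite ge_max !le_max lexx cd orbT.
Qed.

Lemma utility_functional_le c d : L1_loc c -> L1_loc d ->
  {ae mu, forall t, 0 <= t -> c t <= d t} -> (U c <= U d)%E.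
Proof.
move=> Lc Ld cd; rewrite !(utility_functionalE _ hu).
apply: ae_ge0_le_integral => //.
- by move=> t _; rewrite lee_fin payoff_ge0.
- exact: measurable_EFin_payoff.
- by move=> t _; rewrite lee_fin payoff_ge0.
- exact: measurable_EFin_payoff.
- apply: (ae_imply cd) => t cdt; rewrite /= in_itv/= andbT => t0.
  by rewrite lee_fin; apply: payoff_le; exact: cdt.
Qed.

Lemma value_increment (K : R) : 0 <= K -> exists2 kappa, 0 < kappa &
  forall k0 h, 0 <= k0 <= K -> 0 < h <= 1 -> V k0 + kappa * h <= V (k0 + h).
Proof.
move=> K0; have [A [B [A0 B0 hAB]]] := control_bound hF heps0.
have ABK : 0 <= A + B * K by rewrite addr_ge0// mulr_ge0.
(* [N] exceeds twice the bound on the integral of consumption, so that the loss c / N in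
   [util_increment] averages to at most one half. *)
pose N := 2 * (A + B * K) + 1; have N0 : 0 < N by rewrite /N; lra.
pose D := u (N + 1) - u N.
have D0 : 0 < D by rewrite subr_gt0; apply: (util_increasing hu); [exact: ltW|rewrite ltrDl].
pose E1 := expR (- (1 * 1) : R); have E10 : 0 < E1 := expR_gt0 _.
pose Er := expR (- (rho * 1)); have Er0 : 0 < Er := expR_gt0 _.
exists (Er * E1 * D / 2) => [|k0 h /andP[k00 k0K] /andP[h0 h1]].
  by rewrite divr_gt0 ?mulr_gt0.
have kh0 : 0 <= k0 + h by lra.
pose K' := Er * (h * E1) * D.
have K'0 : 0 <= K' by rewrite !mulr_ge0// ltW.
have -> : Er * E1 * D / 2 * h = K' / 2 by rewrite /K'; ring.
rewrite -lerBrDr; apply: (value_le hF hrho hu heps0 hgrowth) => // c adm.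
have [Lc c0 [k [k0E ack dk] kge0]] := adm.
pose e t : R := h * expR (- (1 * t)).
have e0 t : 0 <= e t by rewrite mulr_ge0 ?expR_ge0// ltW.
pose kk t := k t + e t.
(* This is F(kk) - kk' for the raised path, where k' = F(k) - c. *)
pose cc t := F (kk t) - F (k t) + e t + c t.
have ace T : 0 <= T -> absolutely_continuous 0 T e.
  by move=> T0; apply: acM => //; [exact: ac_cst|exact: ac_expRN].
have ackk T : 0 <= T -> absolutely_continuous 0 T kk.
  by move=> T0; apply: acD; [exact: ack|exact: ace].
have cec t : 0 <= t -> c t + e t <= cc t.
  move=> t0; have : F (k t) <= F (kk t) by apply: (prod_nd hF); rewrite lerDl.
  by rewrite /cc; lra.
have Lcc : L1_loc cc.
  move=> T T0; have h2 := Lc T T0.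
  have h1' : mu.-integrable `[0%R, T] (EFin \o (fun t => F (kk t) - F (k t) + e t)).
    apply: (@L1_loc_continuous R (fun t => F (kk t) - F (k t) + e t)) => // T' T'0.
    have ck := ac_continuous (ack T' T'0); have ckk := ac_continuous (ackk T' T'0).
    have ce := ac_continuous (ace T' T'0).
    have Fk g := @within_continuous_postcomp R `[0, T']%classic F g ^~ (prod_continuous hF).
    exact: (within_continuousD (within_continuousB (Fk _ ckk) (Fk _ ck)) ce).
  apply: eq_integrable (integrableD _ h1' h2) => //.
have admcc : admissible F (k0 + h) cc.
  split => //.
  - apply: (ae_imply c0) => t ct t0; have := cec t t0; have := ct t0; have := e0 t; lra.
  - exists kk => [|t t0]; last by rewrite addr_ge0// kge0.
    split => //; first by rewrite /kk /e k0E mulr0 oppr0 expR0 mulr1.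
    apply: (ae_imply dk) => t + t0 => /(_ t0) dkt.
    have := is_derive_addf dkt (is_derive_scalef h (is_derive_expRN 1 t)).
    by congr (is_derive _ _ _ _); rewrite /cc /e; ring.
have Lcs : L1_loc (fun t => c (t + 1)).
  by have [] := admissible_shift ler01 Lc c0 (And3 k0E ack dk) kge0.
have Lccs : L1_loc (fun t => cc (t + 1)).
  have [_ cc0 [kk' solkk kk'0]] := admcc.
  by have [] := admissible_shift ler01 Lcc cc0 solkk kk'0.
(* After time 1 monotonicity suffices; the strict gain is collected on [0, 1]. *)
have H2 : (U (fun t => c (t + 1)%R) <= U (fun t => cc (t + 1)%R))%E.
  apply: utility_functional_le => //; apply: aeW => t t0.
  by apply: le_trans (cec _ _); rewrite ?lerDl// addr_ge0.
have mc1 : measurable_fun `[(0 : R), 1] (fun t => Num.max 0 (c t)).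
  apply: measurable_maxr => //.
  by apply: measurable_funS (L1_loc_measurable Lc) => //; exact: subset_itvl.
have mP d : L1_loc d -> measurable_fun `[(0 : R), 1] (fun t => (payoff u rho d t)%:E).
  by move=> Ld; apply: measurable_EFin_payoff => //; exact: subset_itvl.
have pos1 t : (0 <= (K' / N * Num.max 0 (c t))%:E)%E.
  by rewrite lee_fin mulr_ge0 ?divr_ge0 ?le_max ?lexx// ltW.
have mc1' : measurable_fun `[(0 : R), 1] (fun t => (K' / N * Num.max 0 (c t))%:E).
  by apply/measurable_EFinP; apply: measurable_funM.
(* [K'] is the gain before the correction c / N, and [K' / 2] on the right bounds the integral of
   that correction; this form avoids subtracting extended reals. *)
have H1 : (\int[mu]_(t in `[0%R, 1%R]) (payoff u rho c t)%:E + K'%:E <=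
    \int[mu]_(t in `[0%R, 1%R]) (payoff u rho cc t)%:E + (K' / 2)%:E)%E.
  have cstK : (K'%:E = \int[mu]_(t in `[0%R, 1%R]) K'%:E)%E.
    by rewrite integral_cst//= lebesgue_measure_itv/= lte_fin ltr01 -EFinD subr0 mule1.
  apply: (@le_trans _ _ (\int[mu]_(t in `[0%R, 1%R]) (payoff u rho cc t)%:E +
    \int[mu]_(t in `[0%R, 1%R]) (K' / N * Num.max 0 (c t))%:E)%E); last first.
    rewrite leeD2l//.
    under eq_integral do rewrite EFinM.
    have KN0 : (0 <= (K' / N)%:E)%E by rewrite lee_fin divr_ge0// ltW.
    rewrite ge0_integralZl//; first last.
    - by move=> t _; rewrite lee_fin le_max lexx.
    - exact/measurable_EFinP.
    have := hAB k0 c k00 adm; set I := (\int[_]_(_ in _) _)%E => HI.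
    apply: le_trans (lee_wpmul2l KN0 HI) _; rewrite -EFinM lee_fin.
    rewrite -mulrA ler_wpM2l// mulrC ler_pdivrMr//.
    have : B * k0 <= B * K by rewrite ler_wpM2l.
    by rewrite /N; lra.
  rewrite [X in (_ + X <= _)%E]cstK -!ge0_integralD//; first last.
  - exact: mP.
  - by move=> t _; rewrite lee_fin payoff_ge0.
  - exact: mP.
  - by move=> t _; rewrite lee_fin payoff_ge0.
  apply: ae_ge0_le_integral => //.
  - by move=> t _; rewrite -EFinD lee_fin addr_ge0// payoff_ge0.
  - by apply: emeasurable_funD => //; exact: mP.
  - by move=> t _; rewrite adde_ge0// lee_fin payoff_ge0.
  - by apply: emeasurable_funD => //; exact: mP.
  - apply: (ae_imply c0) => t ct; rewrite /= in_itv/= => /andP[t0 t1].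
    have ct0 := ct t0; rewrite -!EFinD lee_fin /payoff.
    have hE1 : 0 <= h * E1 <= 1.
      apply/andP; split; first by apply: mulr_ge0; exact: ltW.
      apply: mulr_ile1 => //; [exact: ltW|exact: ltW|].
      by rewrite /E1 -[leRHS]expR0 ler_expR; lra.
    have cd : c t + h * E1 <= cc t.
      apply: le_trans (cec t t0); rewrite lerD2l; apply: ler_wpM2l; first exact: ltW.
      by rewrite ler_expR; lra.
    have cc0 : 0 <= cc t by have /andP[] := hE1; lra.
    rewrite (max_idPr ct0) (max_idPr cc0).
    have i1 := util_increment hu N0 ct0 hE1.
    have i2 : u (c t + h * E1) <= u (cc t).
      by apply: (util_nd hu) => //; have /andP[] := hE1; lra.
    have i3 : 0 <= u (cc t) - u (c t).
      rewrite subr_ge0; apply: (util_nd hu) => //; have /andP[] := hE1; lra.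
    have i4 : Er * (u (cc t) - u (c t)) <= expR (- (rho * t)) * (u (cc t) - u (c t)).
      by rewrite ler_wpM2r// ler_expR lerN2 ler_wpM2l// ltW.
    have i5 : Er * (h * E1 * D * (1 - c t / N)) <= Er * (u (cc t) - u (c t)).
      by apply: ler_wpM2l; [exact: ltW|rewrite -/D in i1; lra].
    have -> : K' / N * c t = K' * (c t / N) by rewrite mulrAC mulrA.
    have : Er * (h * E1 * D * (1 - c t / N)) = K' - K' * (c t / N) by rewrite /K'; ring.
    lra.
have Uc := value_ubound hF hrho hu heps0 hgrowth k00 adm.
have Ucc := value_ubound hF hrho hu heps0 hgrowth kh0 admcc.
have Ucfin : U c \is a fin_num.
  by rewrite ge0_fin_numE ?(utility_functional_ge0 _ hu)//; apply: le_lt_trans (ltry (V k0)).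
suff : (U c + K'%:E <= (V (k0 + h)%R)%:E + (K' / 2)%:E)%E.
  by rewrite -(fineK Ucfin) -!EFinD !lee_fin => ?; lra.
apply: (@le_trans _ _ (U cc + (K' / 2)%:E)%E); last by rewrite leeD2r.
rewrite (utility_functional_split _ hu ler01 Lc Lcs) (utility_functional_split _ hu ler01 Lcc Lccs).
rewrite addeAC [leRHS]addeAC; apply: leeD => //.
by apply: lee_wpmul2l => //; rewrite lee_fin expR_ge0.
Qed.

End Increment.

(** * Monotonicity and continuity of the value function *)

Section Viscosity.
Variables (R : realType) (F u : R -> R) (L rho eps0 : R).
Hypothesis hF : production_function F L.
Hypothesis hrho : 0 < rho.
Hypothesis hu : utility_function u.
Hypothesis heps0 : 0 < eps0.
Hypothesis hgrowth : growth_condition u rho L eps0.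

Local Notation mu := (@lebesgue_measure R).
Local Notation V := (value F u rho).
Local Notation U := (utility_functional u rho).
Implicit Types (c : R -> R) (T t : R).

Lemma value_lt (x y : R) : 0 <= x -> x < y -> V x < V y.
Proof.
have short a b : 0 <= a -> a < b -> b <= a + 1 -> V a < V b.
  move=> a0 ab ba; have [kappa k0 hk] := value_increment hF hrho hu heps0 hgrowth a0.
  have ba0 : 0 < b - a by rewrite subr_gt0.
  have kba : 0 < kappa * (b - a) by rewrite mulr_gt0.
  have := hk a (b - a); rewrite a0 lexx ba0 (_ : a + (b - a) = b); last by ring.
  have ba1 : b - a <= 1 by lra.
  by move=> /(_ isT ba1); lra.
have long n a b : 0 <= a -> a < b -> b <= a + n%:R -> V a < V b.
  elim: n a b => [|n IH] a b a0 ab; first by rewrite addr0; lra.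
  rewrite -natr1 => ban; have [ba|ab1] := leP b (a + 1); first exact: short.
  apply: (@lt_trans _ _ (V (a + 1))); first by apply: short; lra.
  by apply: IH; lra.
move=> x0 xy; apply: (long (Num.bound (y - x))) => //.
by rewrite -lerBlDl ltW// archi_boundP// subr_ge0 ltW.
Qed.

Lemma value_nd (x y : R) : 0 <= x -> x <= y -> V x <= V y.
Proof.
by move=> x0; rewrite le_eqVlt => /predU1P[->//|xy]; exact/ltW/value_lt.
Qed.

(** Capital can rise from [a] at constant speed F(a) with nonnegative consumption, as F is
    increasing. It reaches [b] after time (b - a) / F(a), and discounting over that time bounds the
    loss. Since F(0) = 0, the speed is bounded below only away from 0, hence the threshold x / 2. *)
Lemma value_lipschitz (x a b : R) : 0 < x -> x / 2 <= a -> a <= b -> b <= x + 1 ->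
  b <= a + 1 -> V b - V a <= rho * V (x + 1) / F (x / 2) * (b - a).
Proof.
move=> x0 xa ab bx ba1.
have x2 : 0 < x / 2 by rewrite divr_gt0.
have a0 : 0 < a by lra.
have Fa := prod_gt0 hF a0; have Fx := prod_gt0 hF x2.
pose tau := (b - a) / F a; have tau0 : 0 <= tau.
  by apply: divr_ge0; [rewrite subr_ge0|exact: ltW].
have bE : a + F a * tau = b.
  by rewrite /tau; field; rewrite gt_eqF.
have pos t : 0 <= t -> a <= a + F a * t by move=> t0; rewrite lerDl mulr_ge0// ltW.
have := dpp_lower hF hrho hu heps0 hgrowth (ltW a0) tau0 (lexx 0) _ _ (v := F a).
rewrite bE (util_0 hu) mulr0 add0r => H.
have {H} : expR (- (rho * tau)) * V b <= V a.
  apply: H => t /andP[t0 _]; first by apply: le_trans (pos t t0); exact: ltW.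
  by rewrite subr_ge0; apply: (prod_nd hF); exact: pos.
have Vb : 0 <= V b by apply: (value_ge0 rho hF hu); lra.
have Vx : 0 <= V (x + 1) by apply: (value_ge0 rho hF hu); lra.
have Vbx : V b <= V (x + 1) by apply: value_nd; lra.
have e1 : 1 - rho * tau <= expR (- (rho * tau)) by exact: expR_ge1Dx.
have : (1 - rho * tau) * V b <= expR (- (rho * tau)) * V b by rewrite ler_wpM2r.
have rt : 0 <= rho * tau by rewrite mulr_ge0// ltW.
have : rho * tau * V b <= rho * tau * V (x + 1) by rewrite ler_wpM2l.
have : rho * tau * V (x + 1) <= rho * V (x + 1) / F (x / 2) * (b - a).
  have -> : rho * tau * V (x + 1) = rho * V (x + 1) * (b - a) * (F a)^-1.
    by rewrite /tau; ring.
  have -> : rho * V (x + 1) / F (x / 2) * (b - a) = rho * V (x + 1) * (b - a) * (F (x / 2))^-1.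
    by ring.
  rewrite ler_wpM2l ?mulr_ge0 ?subr_ge0 ?(ltW hrho)//.
  by rewrite lef_pV2 ?posrE//; exact: (prod_nd hF).
lra.
Qed.

Lemma value_Cplus : Cplus V.
Proof.
split => [x x0|k0 k00].
  apply/cvgrPdist_lt => e e0.
  pose M := rho * V (x + 1) / F (x / 2).
  have x2 : 0 < x / 2 by rewrite divr_gt0.
  have M0 : 0 <= M.
    rewrite /M mulr_ge0 ?mulr_ge0 ?(ltW hrho) ?invr_ge0 ?(ltW (prod_gt0 hF x2))//.
    by apply: (value_ge0 rho hF hu); lra.
  have M10 : 0 < M + 1 by lra.
  pose d := Num.min 1 (Num.min (x / 2) (e / (M + 1))).
  have d0 : 0 < d by rewrite !lt_min ltr01 x2 divr_gt0.
  have d1 : d <= 1 by rewrite ge_min lexx.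
  have d2 : d <= x / 2 by rewrite !ge_min lexx orbT.
  have d3 : d <= e / (M + 1) by rewrite !ge_min lexx !orbT.
  have key a b : x / 2 <= a -> a <= b -> b <= x + 1 -> b - a < d -> `|V b - V a| < e.
    move=> xa ab bx bad; rewrite ger0_norm ?subr_ge0; last by apply: value_nd; lra.
    have ba1 : b <= a + 1 by lra.
    apply: le_lt_trans (value_lipschitz x0 xa ab bx ba1) _; rewrite -/M.
    apply: (@le_lt_trans _ _ ((M + 1) * (b - a))).
      by rewrite ler_wpM2r ?subr_ge0// lerDl.
    by rewrite mulrC -ltr_pdivlMr//; lra.
  apply: filterS (nbhsx_ballx x d d0) => y; rewrite /ball/= => xy.
  have [xley|yltx] := leP x y.
    rewrite distrC in xy; rewrite distrC; have := ler_norm (y - x) => xy'.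
    by apply: key; lra.
  by have := ler_norm (x - y) => xy'; apply: key; lra.
(* One constant serves both sides: a left increment starts from k0 + h, which lies in [0, k0]. *)
have [kappa kp0 hk] := value_increment hF hrho hu heps0 hgrowth (ltW k00).
exists 1, kappa, kappa; split => //.
  move=> h /andP[h0 h1]; rewrite ler_pdivlMr//.
  by have := hk k0 h; rewrite (ltW k00) lexx h0 (ltW h1) => /(_ isT isT); lra.
move=> h /andP[h1 h0] kh0; rewrite ler_ndivlMr//.
have Nh : 0 < - h <= 1 by apply/andP; split; lra.
have kh1 : 0 <= k0 + h <= k0 by apply/andP; split; lra.
have := hk (k0 + h) (- h) kh1 Nh; rewrite addrK; lra.
Qed.

End Viscosity.

Lemma is_derive_oppf (R : realType) (f : R -> R) (t a : R) :
  is_derive t (1 : R) f a -> is_derive t (1 : R) (fun s => - f s) (- a).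
Proof. exact: is_deriveN. Qed.

(** * Viscosity solutions *)

Section Solutions.
Variables (R : realType) (F u : R -> R) (L rho eps0 : R).
Hypothesis hF : production_function F L.
Hypothesis hrho : 0 < rho.
Hypothesis hu : utility_function u.
Hypothesis heps0 : 0 < eps0.
Hypothesis hgrowth : growth_condition u rho L eps0.

Local Notation mu := (@lebesgue_measure R).
Local Notation V := (value F u rho).
Local Notation U := (utility_functional u rho).
Implicit Types (c phi : R -> R) (T t : R).

Lemma C1_pos_is_derive phi (x : R) : C1_pos phi -> 0 < x ->
  is_derive x (1 : R) phi (derive1 phi x).
Proof. by move=> [dphi _] x0; apply: DeriveDef; [exact: dphi|rewrite derive1E]. Qed.

Lemma local_minE phi (k0 : R) : local_min (fun k => V k - phi k) k0 ->
  exists2 r, 0 < r & forall y, `|y - k0| < r -> V k0 - phi k0 <= V y - phi y.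
Proof.
move=> /nbhs_ballP[r /= r0 hr]; exists r => // y yr; apply: (hr y).
by rewrite /ball/= distrC.
Qed.

Lemma supersolution_linear phi (k0 v m : R) : C1_pos phi -> 0 < k0 -> 0 <= m ->
  local_min (fun k => V k - phi k) k0 ->
  (exists2 r, 0 < r & forall t, 0 <= t -> `|v * t| < r -> m <= F (k0 + v * t) - v) ->
  u m + v * derive1 phi k0 <= rho * V k0.
Proof.
move=> Cphi k00 m0 /local_minE[r1 r10 hr1] [r2 r20 hr2].
(* Dynamic programming along the line and the local minimum give psi(h) >= psi(0) for small h > 0,
   so psi'(0) >= 0, which is the claim. [V] enters only through its value at [k0] and is not
   differentiated. *)
pose psi (s : R) := expR (rho * s) * V k0 - phi (k0 + v * s) - u m * s.
have dpsi : is_derive 0 (1 : R) psi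
    (expR (rho * 0) * rho * V k0 - derive1 phi k0 * v - u m).
  have phi' : is_derive (k0 + v * 0) (1 : R) phi (derive1 phi k0).
    by rewrite mulr0 addr0; exact: C1_pos_is_derive.
  have d2 := @is_derive_compf R phi (fun s => k0 + v * s) 0 _ v phi' (is_derive_affine k0 v 0).
  have d1 := is_derive_mulf (is_derive_expRM rho 0) (is_derive_cst (V k0) (0 : R) (1 : R)).
  have := is_derive_subf (is_derive_subf d1 d2) (is_derive_scale (u m) 0).
  by rewrite mulr0 add0r [V k0 * _]mulrC.
pose r := Num.min k0 (Num.min r1 r2).
have r0 : 0 < r by rewrite !lt_min k00 r10.
have rk : r <= k0 by rewrite ge_min lexx.
have rr1 : r <= r1 by rewrite !ge_min lexx orbT.
have rr2 : r <= r2 by rewrite !ge_min lexx !orbT.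
have v1 : 0 < `|v| + 1 by rewrite ltr_wpDl.
have d0 : 0 < r / (`|v| + 1) by rewrite divr_gt0.
have small t h : 0 <= t -> t <= h -> h < r / (`|v| + 1) -> `|v * t| < r.
  move=> t0 th hr; rewrite normrM [`|t|]ger0_norm//.
  apply: (@le_lt_trans _ _ ((`|v| + 1) * t)); first by rewrite ler_wpM2r// lerDl.
  by rewrite mulrC -ltr_pdivlMr//; exact: le_lt_trans hr.
have := derive_ge0_right d0 dpsi; rewrite mulr0 expR0 mul1r => H.
suff : 0 <= rho * V k0 - derive1 phi k0 * v - u m by lra.
apply: H => h /andP[h0 hd].
have dl := @dpp_lower R F u L rho eps0 hF hrho hu heps0 hgrowth k0 v h m (ltW k00) (ltW h0) m0.
have {dl} : expR (- (rho * h)) * (h * u m + V (k0 + v * h)) <= V k0.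
  apply: dl => t /andP[t0 th]; have vt := small t h t0 th hd.
    by have := ler_norm (- (v * t)); rewrite normrN; lra.
  by apply: hr2 => //; exact: lt_le_trans rr2.
rewrite expRN mulrC ler_pdivrMr ?expR_gt0// => dl.
have vh := small h h (ltW h0) (lexx _) hd.
have := hr1 (k0 + v * h); rewrite (_ : k0 + v * h - k0 = v * h); last by ring.
move=> /(_ (lt_le_trans vh rr1)) lm.
rewrite /psi !mulr0 expR0 mul1r addr0 subr0 add0r.
rewrite [expR _ * _]mulrC; lra.
Qed.

Lemma value_supersolution : viscosity_supersolution F u rho V.
Proof.
split; first exact: (value_Cplus hF hrho hu heps0 hgrowth).
move=> phi Cphi k0 k00 lmin; rewrite /hamiltonian subr_ge0.
have low := supersolution_linear Cphi k00 _ lmin.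
apply: ge_sup.
  by exists ((F k0 - 0) * derive1 phi k0 + u 0), 0 => //; rewrite /= in_itv/= lexx.
move=> _ [c + <-]; rewrite /= in_itv/= andbT => c0.
(* No level m < c is available at c = 0; there the line has speed F(k0), along which consumption
   stays nonnegative because F is increasing. *)
move: c0; rewrite le_eqVlt => /predU1P[<-|c0].
  rewrite subr0 addrC; apply: (low (F k0) 0) => //; exists 1 => // t t0 _.
  rewrite subr_ge0; apply: (prod_nd hF); rewrite lerDl mulr_ge0//.
  by apply: (prod_ge0 hF); exact: ltW.
rewrite -lerBrDl; apply: (util_left_continuous hu c0) => m /andP[m0 mc].
rewrite lerBrDr; apply: low => //.
have cm : 0 < c - m by rewrite subr_gt0.
have Fk0 : {for k0, continuous F} by exact: (prod_continuous hF).
move/cvgrPdist_lt : Fk0 => /(_ _ cm) /nbhs_ballP[r /= r0 hr].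
exists r => // t t0 vt; have := hr (k0 + (F k0 - c) * t).
rewrite /ball/= (_ : k0 - (k0 + (F k0 - c) * t) = - ((F k0 - c) * t)); last by ring.
rewrite normrN => /(_ vt) h; have := ler_norm (F k0 - F (k0 + (F k0 - c) * t)); lra.
Qed.

(** A convex combination of two bounds: the hypothesis, with weight 1 - l, gives a constant gap, and
    sublinearity with slope p / 2, with weight l, gives a gap growing with y. The second may exceed
    K by [B]; the choice l (B + e) = e / 2 keeps half of the gap e. *)
Lemma util_coercive_slack (p K e : R) : 0 < p -> 0 < e ->
  (forall y, 0 <= y -> u y - p * y <= K - e) ->
  exists2 eta, 0 < eta & forall y, 0 <= y -> u y - p * y <= K - 2 * eta * (1 + y).
Proof.
move=> p0 e0 ub; have p20 : 0 < p / 2 by rewrite divr_gt0.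
have [A A0 hA] := util_sublinear hu p20.
pose B := `|A - K|; have B0 : 0 <= B := normr_ge0 _.
have AKB : A - K <= B := ler_norm _.
pose l := e / (2 * (B + e)).
have Be : 0 < 2 * (B + e) by rewrite mulr_gt0// ltr_wpDl.
have l0 : 0 < l by rewrite divr_gt0.
have l1 : l <= 1 by rewrite ler_pdivrMr// mul1r; lra.
have lBe : l * (B + e) = e / 2.
  by rewrite /l; field; rewrite gt_eqF// ltr_wpDl.
pose eta := Num.min (e / 4) (l * p / 4).
have eta1 : eta <= e / 4 by rewrite ge_min lexx.
have eta2 : eta <= l * p / 4 by rewrite ge_min lexx orbT.
have lp : 0 < l * p by exact: mulr_gt0.
exists eta => [|c c0]; first by rewrite lt_min; apply/andP; split; lra.
have h1 : (1 - l) * (u c - p * c - K) <= (1 - l) * (- e).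
  by apply: ler_wpM2l; [lra|have := ub c c0; lra].
have h2 : l * (u c - p * c - K) <= l * (B - p / 2 * c).
  by apply: ler_wpM2l; [exact: ltW|have := hA c c0; lra].
have h3 : eta * c <= l * p / 4 * c by rewrite ler_wpM2r.
lra.
Qed.

Lemma first_exit_trajectory (k0 r : R) c k : 0 < r -> state_solution F k0 c k ->
  exists th, [/\ 0 <= th <= 1, forall t, 0 <= t <= th -> `|k t - k0| <= r &
    th = 1 \/ `|k th - k0| = r].
Proof.
move=> r0 [k0E ack _]; apply: (@first_exit R (fun t => `|k t - k0|) 1 r) => //.
  move=> e e0; have [d d0 hd] := ac_uniform (ack 1 ler01) e0; exists d => // x y x1 y1 xy.
  apply: le_lt_trans (hd x y x1 y1 xy).
  by apply: le_trans (ler_dist_dist _ _) _; rewrite opprB addrA subrK.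
by rewrite k0E subrr normr0.
Qed.

(** To the right of [k0] the test function increases at least as much as [V], hence with slope at
    least the constant of C^+. A positive slope is what bounds the set in the Hamiltonian. *)
Lemma test_slope_gt0 phi (k0 : R) : C1_pos phi -> 0 < k0 ->
  local_max (fun k => V k - phi k) k0 -> 0 < derive1 phi k0.
Proof.
move=> Cphi k00 /nbhs_ballP[r /= r0 hr].
have [_ /(_ k0 k00)[d [Cp [Cm [d0 Cp0 _ hCp _]]]]] := value_Cplus hF hrho hu heps0 hgrowth.
have dk := is_derive_subf (C1_pos_is_derive Cphi k00) (is_derive_scale Cp k0).
have rd : 0 < Num.min r d by rewrite lt_min r0.
have := derive_ge0_right rd dk; rewrite subr_ge0 => H.
apply: lt_le_trans Cp0 _; apply: H => h /andP[h0]; rewrite lt_min => /andP[hr' hd'].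
have := hr (k0 + h); rewrite /ball/= opprD addrA subrr sub0r normrN gtr0_norm// => /(_ hr').
have := hCp h; rewrite h0 hd' => /(_ isT); rewrite ler_pdivlMr//.
lra.
Qed.

End Solutions.

(** * The subsolution property *)

Lemma dist_between (R : realType) (x y z a r : R) : `|x - a| <= r -> `|y - a| <= r ->
  (x <= z <= y) || (y <= z <= x) -> `|z - a| <= r.
Proof.
rewrite !ler_distl => /andP[? ?] /andP[? ?].
by case/orP => /andP[? ?]; apply/andP; split; lra.
Qed.

(** The test function is Lipschitz only on a ball around [k0]; convexity of the ball keeps the mean
    value points inside it. *)
Lemma ac_comp_derive (R : realType) (a b x0 r M : R) (phi dphi k : R -> R) : 0 <= M ->
  (forall z, `|z - x0| <= r -> is_derive z (1 : R) phi (dphi z)) ->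
  (forall z, `|z - x0| <= r -> `|dphi z| <= M) ->
  (forall t, a <= t <= b -> `|k t - x0| <= r) ->
  absolutely_continuous a b k -> absolutely_continuous a b (fun t => phi (k t)).
Proof.
move=> M0 dphiE dphiM kr ack; apply: (@ac_comp_lipschitz R a b M _ k M0 _ ack) => x y xab yab.
have inball z := @dist_between R _ _ z _ _ (kr x xab) (kr y yab).
have lip p q : p <= q -> (forall z, p <= z <= q -> `|z - x0| <= r) ->
    `|phi q - phi p| <= M * `|q - p|.
  move=> pq pqr; have [z /pqr zr|z /pqr zr ->] := @mean_value R phi dphi p q pq.
    exact: dphiE.
  by rewrite normrM ler_wpM2r// dphiM.
have [xy|yx] := leP (k x) (k y).
  by apply: lip => // z zxy; apply: inball; rewrite zxy.
rewrite distrC [`|k y - k x|]distrC; apply: lip; first exact: ltW.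
by move=> z zxy; apply: inball; rewrite zxy orbT.
Qed.

(* The three choices of (al, be) are (1, 0), (0, 1) and (0, -1): staying in the
   ball, leaving it to the right, leaving it to the left. *)
Lemma exit_displacement (R : realType) (th x r B : R) : 0 <= B ->
  th = 1 \/ `|x| = r ->
  exists al be, (forall X Y, 0 <= X <= B -> 0 <= Y ->
      al + be * (X - Y) <= (1 + B) * (1 + Y)) /\
    Num.min 1 r <= al * th + be * x.
Proof.
move=> B0 exit.
have BY Y : 0 <= Y -> 0 <= B * Y by move=> Y0; rewrite mulr_ge0.
have mr1 : Num.min 1 r <= 1 by rewrite ge_min lexx.
have mr2 : Num.min 1 r <= r by rewrite ge_min lexx orbT.
case: exit => [->|xr].
  exists 1, 0; split=> [X Y /andP[X0 XB] Y0|]; last by lra.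
  by have := BY Y Y0; lra.
have [h|h] := leP 0 x.
  rewrite ger0_norm// in xr; exists 0, 1; split=> [X Y /andP[X0 XB] Y0|]; last by lra.
  by have := BY Y Y0; lra.
rewrite ltr0_norm// in xr; exists 0, (-1); split=> [X Y /andP[X0 XB] Y0|]; last by lra.
by have := BY Y Y0; lra.
Qed.

(** Moving from [k0] to a nearby state costs eta c for the slope and eta / 2 for each of the two
    other errors, so half of the slack 2 eta (1 + c) remains. *)
Lemma hamiltonian_perturbation (R : realType) (rho eta uc c p D X X0 v dv : R) :
  0 < rho -> 0 <= c ->
  uc - p * c <= rho * v - p * X0 - 2 * eta * (1 + c) ->
  `|D - p| <= eta -> `|D * X - p * X0| <= eta / 2 -> rho * `|dv| <= eta / 2 ->
  uc + D * (X - c) - rho * (v + dv) <= - (eta * (1 + c)).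
Proof.
move=> rho0 c0 h s1 s2 s3.
have h1 : (p - D) * c <= eta * c.
  by apply: ler_wpM2r => //; apply: le_trans s1; rewrite distrC ler_norm.
have h2 : D * X - p * X0 <= eta / 2 by apply: le_trans s2; exact: ler_norm.
have h3 : - (rho * dv) <= eta / 2.
  by apply: le_trans s3; rewrite -mulrN ler_wpM2l ?(ltW rho0)// -normrN ler_norm.
lra.
Qed.

Section Subsolution.
Variables (R : realType) (F u : R -> R) (L rho eps0 : R).
Hypothesis hF : production_function F L.
Hypothesis hrho : 0 < rho.
Hypothesis hu : utility_function u.
Hypothesis heps0 : 0 < eps0.
Hypothesis hgrowth : growth_condition u rho L eps0.

Local Notation mu := (@lebesgue_measure R).
Local Notation V := (value F u rho).
Local Notation U := (utility_functional u rho).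
Implicit Types (c phi : R -> R) (T t : R).

Lemma value_subsolution : viscosity_subsolution F u rho V.
Proof.
split; first exact: (value_Cplus hF hrho hu heps0 hgrowth).
move=> phi Cphi k0 k00 lmax.
have p0 := test_slope_gt0 hF hrho hu heps0 hgrowth Cphi k00 lmax; set p := derive1 phi k0 in p0 *.
rewrite leNgt; apply/negP; rewrite /hamiltonian subr_gt0.
set S := [set _ | _ in _] => supS.
have p20 : 0 < p / 2 by rewrite divr_gt0.
have [A A0 hA] := util_sublinear hu p20.
(* For an unbounded set [sup] is a default value that bounds nothing. *)
have ubS : has_ubound S.
  exists (A + p * F k0) => _ [y + <-]; rewrite /= in_itv/= andbT => y0.
  have : 0 <= p / 2 * y by rewrite mulr_ge0// ltW.
  have := hA y y0; lra.
pose e := rho * V k0 - sup S; have e0 : 0 < e by rewrite subr_gt0.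
have [|eta eta0 heta] := @util_coercive_slack R u hu p (rho * V k0 - p * F k0) e p0 e0.
  move=> y y0; have : (F k0 - y) * p + u y <= sup S.
    by apply: ub_le_sup => //; exists y => //; rewrite /= in_itv/= y0.
  by rewrite /e; lra.
have eta20 : 0 < eta / 2 by rewrite divr_gt0.
have etar0 : 0 < eta / 2 / rho by rewrite divr_gt0.
have cphi' : {for k0, continuous (derive1 phi)} by exact: Cphi.2.
have cF : {for k0, continuous F} by exact: (prod_continuous hF).
have cphi : {for k0, continuous phi} by exact: is_derive_continuous (C1_pos_is_derive Cphi k00).
have cphiF : {for k0, continuous (fun k => derive1 phi k * F k)} by exact: continuousM.
(* The tolerances are those of [hamiltonian_perturbation]; halving the radius gives a closed ball,
   which contains the exit point. *)
have [r r0 hr] : exists2 r, 0 < r & forall x, `|x - k0| <= r ->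
    [/\ 0 < x, `|derive1 phi x - p| <= eta, `|derive1 phi x * F x - p * F k0| <= eta / 2,
      rho * `|phi x - phi k0| <= eta / 2 & V x - phi x <= V k0 - phi k0].
  move/cvgrPdist_lt : cphi' => /(_ _ eta0) n1.
  move/cvgrPdist_lt : cphiF => /(_ _ eta20) n2.
  move/cvgrPdist_lt : cphi => /(_ _ etar0) n3.
  have n4 : \forall x \near k0, 0 < x by exact: lt_nbhsr.
  have : \forall x \near k0, [/\ 0 < x, `|derive1 phi k0 - derive1 phi x| < eta,
    `|derive1 phi k0 * F k0 - derive1 phi x * F x| < eta / 2,
    `|phi k0 - phi x| < eta / 2 / rho & V x - phi x <= V k0 - phi k0].
    by apply: filterS3 (filterI n1 n2) (filterI n3 n4) lmax => x [? ?] [? ?] ?; split.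
  move=> /nbhs_ballP[r /= r0 hr]; exists (r / 2) => [|x xr]; first by rewrite divr_gt0.
  have [|x0 h1 h2 h3 h4] := hr x; first by rewrite /ball/= distrC; lra.
  split => //.
  - by rewrite distrC ltW.
  - by rewrite distrC ltW.
  - by rewrite distrC mulrC -ler_pdivlMr// ltW.
have V0 : 0 <= V k0 by apply: (value_ge0 rho hF hu); exact: ltW.
pose Fm := F (k0 + r).
have Fm0 : 0 <= Fm by apply: (prod_ge0 hF); lra.
have Fm1 : 0 < 1 + Fm by lra.
(* Chosen so that kappa (1 + Fm) (1 + c) = e^{-rho} eta (1 + c), at most the discounted defect at
   times up to 1. *)
pose kappa := expR (- (rho * 1)) * eta / (1 + Fm).
have kappa0 : 0 < kappa by rewrite divr_gt0 ?mulr_gt0 ?expR_gt0.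
have mr0 : 0 < Num.min 1 r by rewrite lt_min ltr01.
have mr1 : Num.min 1 r <= 1 by rewrite ge_min lexx.
have mr2 : Num.min 1 r <= r by rewrite ge_min lexx orbT.
have km0 : 0 < kappa * Num.min 1 r by rewrite mulr_gt0.
(* The control is optimal up to the gain [kappa * Num.min 1 r] that will have accumulated at the
   exit. *)
have [c adm Uc] := value_adherent hF hrho hu heps0 hgrowth (ltW k00) km0.
have [Lc c0 [k sol kge0]] := adm; have [k0E ack dk] := sol.
have [th [/andP[th0 th1] kr exit]] := first_exit_trajectory r0 sol.
have [al [be [alb mdisp]]] := exit_displacement Fm0 exit.
have kball t : 0 <= t <= th -> `|k t - k0| <= r by exact: kr.
(* [V] is replaced by [V k0 + (phi (k t) - phi k0)], which dominates it in the ball, agrees with it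
   at [k0], and can be differentiated along the trajectory. *)
pose g t := - (expR (- (rho * t)) * (V k0 + (phi (k t) - phi k0))) - kappa * (al * t + be * k t).
have ackth : absolutely_continuous 0 th k by exact: ack.
have acphi : absolutely_continuous 0 th (fun t => phi (k t)).
  have pe0 : 0 <= p + eta by exact: addr_ge0 (ltW p0) (ltW eta0).
  apply: (ac_comp_derive pe0 _ _ kball ackth (dphi := derive1 phi)) => z /hr[z0 h _ _ _].
    exact: C1_pos_is_derive.
  rewrite -[derive1 phi z](subrK p) addrC (le_trans (ler_normD _ _))//.
  by rewrite gtr0_norm// lerD2l.
have acg : absolutely_continuous 0 th g.
  apply: acB.
    have := acM th0 (ac_expRN th (ltW hrho))
      (acD (ac_cst 0 th (V k0)) (acB acphi (ac_cst 0 th (phi k0)))).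
    move=> h; apply: (ac_comp_lipschitz ler01 _ h) => x y _ _.
    by rewrite mul1r -opprD normrN.
  apply: acM => //; first exact: ac_cst.
  apply: acD; first by apply: acM => //; [exact: ac_cst|exact: ac_id].
  by apply: acM => //; exact: ac_cst.
have mp : measurable_fun `[(0 : R), th] (payoff u rho c).
  by apply: measurable_funS (measurable_payoff rho hu Lc) => //; exact: subset_itvl.
have := @trajectory_integral_le R F k0 c k th (payoff u rho c) g th0 adm sol mp.
move=> /(_ (fun t _ => payoff_ge0 rho hu c t) acg) H.
have {}H : (\int[mu]_(t in `[0%R, th]) (payoff u rho c t)%:E <= (g th - g 0)%:E)%E.
  apply: H => t /[dup] tth /andP[t0 tth'] ct dkt.
  have [kt0 s1 s2 s3 _] := hr (k t) (kball t tth).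
  have dphi := @is_derive_compf R phi k t _ _ (C1_pos_is_derive Cphi kt0) dkt.
  have dPhi := is_derive_addf (is_derive_cst (V k0) t (1 : R))
    (is_derive_subf dphi (is_derive_cst (phi k0) t (1 : R))).
  have d1 := is_derive_oppf (is_derive_mulf (is_derive_expRN rho t) dPhi).
  have d2 := is_derive_scalef kappa
    (is_derive_addf (is_derive_scale al t) (is_derive_scalef be dkt)).
  eexists; last exact: (is_derive_subf d1 d2).
  rewrite /payoff (max_idPr ct) subr0 add0r; change (cst (V k0) t) with (V k0).
  set E := expR (- (rho * t)); set D := derive1 phi (k t) in s1 s2 *.
  set X := F (k t) in s2 *; set dp := phi (k t) - phi k0 in s3 *.
  have E0 : 0 <= E := expR_ge0 _.
  have XFm : 0 <= X <= Fm.
    rewrite (prod_ge0 hF) ?(ltW kt0)//= (prod_nd hF)//.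
    by have := kball t tth; rewrite ler_distl => /andP[].
  have b1 : u (c t) + D * (X - c t) - rho * (V k0 + dp) <= - (eta * (1 + c t)).
    exact: hamiltonian_perturbation hrho ct (heta (c t) ct) s1 s2 s3.
  have b2 : E * (u (c t) + D * (X - c t) - rho * (V k0 + dp)) <= E * - (eta * (1 + c t)).
    by rewrite ler_wpM2l.
  have b3 : expR (- (rho * 1)) * (eta * (1 + c t)) <= E * (eta * (1 + c t)).
    apply: ler_wpM2r; first exact: mulr_ge0 (ltW eta0) (addr_ge0 ler01 ct).
    by rewrite ler_expR lerN2 ler_wpM2l ?(ltW hrho)//; exact: le_trans th1.
  have b4 : kappa * (al + be * (X - c t)) <= kappa * ((1 + Fm) * (1 + c t)).
    by apply: ler_wpM2l; [exact: ltW|exact: alb].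
  have b5 : kappa * ((1 + Fm) * (1 + c t)) = expR (- (rho * 1)) * (eta * (1 + c t)).
    by rewrite /kappa; field; rewrite gt_eqF.
  lra.
have Uup := dpp_upper hF hrho hu heps0 hgrowth th0 Lc c0 sol kge0.
have := lt_le_trans Uc (le_trans Uup (leeD H (lexx _))).
have [_ _ _ _ lm] := hr (k th) (kball th (introT andP (conj th0 (lexx th)))).
rewrite -EFinD lte_fin /g k0E !mulr0 oppr0 expR0.
have : kappa * Num.min 1 r <= kappa * (al * th + be * (k th - k0)).
  by apply: ler_wpM2l => //; exact: ltW.
have : expR (- (rho * th)) * (V (k th) - (V k0 + (phi (k th) - phi k0))) <= 0.
  by apply: mulr_ge0_le0; [exact: expR_ge0|lra].
lra.
Qed.

End Subsolution.

Lemma C1_nonneg_C1_pos (R : realType) (f : R -> R) : C1_nonneg f -> C1_pos f.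
Proof.
move=> [g [cg fg _]].
have f'g x : 0 < x -> derive1 f x = g x.
  by move=> x0; rewrite derive1E; apply: (@derive_val _ _ _ _ _ _ _ (fg x x0)).
split=> x x0; first exact: (@ex_derive _ _ _ _ _ _ _ (fg x x0)).
have near_pos : \forall y \near x, 0 < y by exact: lt_nbhsr.
have gx : g y @[y --> x] --> g x.
  have /subspace_continuousP /(_ x) := cg.
  rewrite /= in_itv/= andbT (ltW x0) => /(_ isT); rewrite /from_subspace/= within_interior//.
  rewrite /interior/=; apply: filterS near_pos => y y0.
  by rewrite /= in_itv/= andbT ltW.
rewrite /prop_for /continuous_at f'g//; apply: cvg_trans gx.
apply: near_eq_cvg; near=> y; rewrite f'g//; near: y; exact: near_pos.
Unshelve. all: by end_near. Qed.

Theorem proposition35 (R : realType) (F u : R -> R) (L rho eps0 : R)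
    (hF : production_function F L)
    (hrho : 0 < rho)
    (hu : utility_function u)
    (heps0 : 0 < eps0)
    (hgrowth : growth_condition u rho L eps0) :
  (forall k : R, 0 <= k -> value_function F u rho k \is a fin_num) /\
  let V := fun k : R => fine (value_function F u rho k) in
  viscosity_solution F u rho V /\
  (C1_nonneg V ->
     (forall x y : R, 0 <= x -> x < y -> V x < V y) /\
     classical_solution F u rho V).
Proof.
have vsub := value_subsolution hF hrho hu heps0 hgrowth.
have vsup := value_supersolution hF hrho hu heps0 hgrowth.
split; first exact: (value_function_fin_num hF hrho hu heps0 hgrowth).
split; first by [].
move=> /C1_nonneg_C1_pos CV; split.
  exact: (value_lt hF hrho hu heps0 hgrowth).
split => //; first exact: (value_Cplus hF hrho hu heps0 hgrowth).
(* [V] is its own test function: [V - V] is constant, so every point is both a local maximum and a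
   local minimum. *)
move=> k k0; apply/eqP; rewrite eq_le; apply/andP; split.
  by apply: vsub.2 => //; rewrite /local_max; near=> y; rewrite !subrr.
by apply: vsup.2 => //; rewrite /local_min; near=> y; rewrite !subrr.
Unshelve. all: by end_near. Qed.
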